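(* Given $\omega_0\in L^\infty(\mathbb{C};\mathbb{C})$, let $\mathbf{v}$ be the velocity field of Yudovich's solution to the planar incompressible Euler system in vorticity form with initial vorticity $\omega_0$, and let $X_t=X(t,\cdot):\mathbb{C}\to\mathbb{C}$ be its flow. Then there exists a constant $C>0$ such that $$\left|\arg\left(\frac{X_t(z)-X_t(0)}{X_t(1)-X_t(0)}\right)\right|\leq C\,\log^{\frac12}\left(\frac1{|z|}\right)\,|z|^{-t\|\omega_0\|_\infty}\,\exp\left(Ct\|\omega_0\|_\infty\right)$$ if both $|z|$ and $t>0$ are small enough (with $z\neq 0$).
   Context: The planar incompressible Euler system in vorticity form is $$\frac{d}{dt}\omega+(\mathbf{v}\cdot\nabla)\omega=0,\qquad \operatorname{div}(\mathbf{v})=0,\qquad \omega(0,\cdot)=\omega_0,$$ where $\omega=\omega(t,z):[0,T]\times\mathbb{C}\to\mathbb{C}$ is the unknown and the velocity field $\mathbf{v}$ is related to $\omega$ by the Biot–Savart law $\mathbf{v}=\frac{i}{2\pi\bar z}\ast\omega$ (convolution in the space variable $z$). Yudovich's solution is the unique solution $\omega\in L^\infty([0,T];L^\infty(\mathbb{C};\mathbb{C}))$ of this system with datum $\omega_0$; the corresponding velocity field $\mathbf{v}$ belongs to the Zygmund class. Its flow is the unique map $X:[0,T]\times\mathbb{C}\to\mathbb{C}$ solving $$\frac{d}{dt}X(t,z)=\mathbf{v}(t,X(t,z)),\qquad X(0,z)=z,$$ and each $X_t=X(t,\cdot)$ is a homeomorphism of $\mathbb{C}$. Convention for the argument: for fixed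 $t$, put $f(z)=\frac{X_t(z)-X_t(0)}{X_t(1)-X_t(0)}$, a homeomorphism of $\mathbb{C}$ with $f(0)=0$ and $f(1)=1$. Then $\arg(f(\cdot))$ denotes a continuous (real-valued, not reduced mod $2\pi$) choice of argument along paths in $\mathbb{C}\setminus\{0\}$, with $\arg(f(1))=0$. For $z=re^{i\theta}$ with $0<r<1$ and $\theta\in[0,2\pi)$, $\arg(f(z))$ is obtained by continuing the argument from the point $1$ along the unit circle arc $s\mapsto e^{is}$, $0\le s\le\theta$, and then along the radial segment from $e^{i\theta}$ to $z$. Thus, up to a bounded error, $|\arg(f(z))|$ is $2\pi$ times the number of times the image $X_t([z,z/|z|])$ winds around $X_t(0)$. *)

(* Defs.v *)
From HB Require Import structures.
From mathcomp Require Import all_boot all_order all_algebra.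
From mathcomp Require Import complex.
From mathcomp Require Import all_classical all_reals all_analysis.
Import Order.TTheory GRing.Theory Num.Theory.
Import numFieldNormedType.Exports.

Set Implicit Arguments.
Unset Strict Implicit.
Unset Printing Implicit Defensive.

Local Open Scope classical_set_scope.
Local Open Scope complex_scope.
Local Open Scope ring_scope.

Section Defs.
Context {R : realType}.

(* The norm `|z| of R[i] is R[i]-valued; this is the modulus as an element of
   R. *)
Definition cmod (z : R[i]) : R := ComplexField.Normc.normc z.

Definition cis (s : R) : R[i] := cos s +i* sin s.

(* R[i] carries no measurable structure: functions on the plane are measured
   and integrated in the real coordinates p = (x, y). *)
Local Notation mR := (measurableTypeR R).

Definition cplx (p : (mR * mR)%type) : R[i] := (p.1 : R) +i* (p.2 : R).

Definition leb1 : {sigma_finite_measure set mR -> \bar R} :=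
  @lebesgue_measure R.

Definition leb2 : set (mR * mR)%type -> \bar R := (leb1 \x leb1)%E.

HB.instance Definition _ := Measure.copy leb2 (leb1 \x leb1)%E.

(* Canonical structure inference does not find the sigma-finiteness of a
   product of sigma-finite measures. *)
Lemma leb2_sigma_finite : sigma_finite setT leb2.
Proof.
have /sigma_finiteP[F [TF ndF Foo]] := sigma_finiteT leb1.
exists (fun n => F n `*` F n).
  rewrite -setXTT TF predeqE => -[x y]; split.
    move=> [/= [n _ Fnx] [k _ Fky]]; exists (maxn n k) => //; split.
    - by move: x Fnx; exact/subsetPset/ndF/leq_maxl.
    - by move: y Fky; exact/subsetPset/ndF/leq_maxr.
  by move=> [n _ []/= ? ?]; split; exists n.
move=> k; have [? ?] := Foo k.
split; first exact: measurableX.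
by rewrite [X in (X < _)%E]product_measure1E// lte_mul_pinfty// ge0_fin_numE.
Qed.

HB.instance Definition _ :=
  Measure_isSigmaFinite.Build _ _ _ leb2 leb2_sigma_finite.

Definition leb3 : {measure set (mR * (mR * mR))%type -> \bar R} :=
  (leb1 \x leb2)%E.

Section ComplexValued.
Context d (U : measurableType d).

Definition cmeasurable (D : set U) (f : U -> R[i]) : Prop :=
  measurable_fun D (fun u => complex.Re (f u)) /\
  measurable_fun D (fun u => complex.Im (f u)).

Definition cintegrable (mu : {measure set U -> \bar R}) (D : set U)
    (f : U -> R[i]) : Prop :=
  mu.-integrable D (fun u => (complex.Re (f u))%:E) /\
  mu.-integrable D (fun u => (complex.Im (f u))%:E).

Definition cintegral (mu : {measure set U -> \bar R}) (D : set U)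
    (f : U -> R[i]) : R[i] :=
  Rintegral mu D (fun u => complex.Re (f u)) +i*
  Rintegral mu D (fun u => complex.Im (f u)).

End ComplexValued.

Definition Linfty_norm (f : R[i] -> R[i]) : \bar R :=
  Lnorm leb2 +oo%E (fun p => (cmod (f (cplx p)))%:E).

Definition Linfty (f : R[i] -> R[i]) : Prop :=
  cmeasurable setT (f \o cplx) /\ (Linfty_norm f < +oo)%E.

Definition slab (T : R) : set (mR * (mR * mR))%type :=
  [set q | (q.1 : R) \in `[0, T]].

(* A class in L^oo([0,T]; L^oo(C; C)) is given by a jointly measurable
   representative. *)
Definition LinftyLinfty (T : R) (w : R -> R[i] -> R[i]) : Prop :=
  cmeasurable (slab T) (fun q => w q.1 (cplx q.2)) /\
  exists M : R,
    {ae leb1, forall t, t \in `[0, T] -> (Linfty_norm (w t) <= M%:E)%E}.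

Definition BS_kernel (z : R[i]) : R[i] := 'i%C / ((2 * pi)%:C * z^*%C).

Definition velocity (w : R -> R[i] -> R[i]) (t : R) (z : R[i]) : R[i] :=
  cintegral leb2 setT (fun p => BS_kernel (z - cplx p) * w t (cplx p)).

(* Boundedness of the vorticity alone does not make the convolution converge,
   because the kernel is not integrable at infinity.  Absolute convergence in
   (t, p) makes velocity w t z meaningful for almost every t and every z, and
   locally integrable in (t, z). *)
Definition BS_convergent (T : R) (w : R -> R[i] -> R[i]) : Prop :=
  forall z : R[i],
    cintegrable leb3 (slab T)
      (fun q => BS_kernel (z - cplx q.2) * w q.1 (cplx q.2)).

Definition dt (phi : R -> R -> R -> R) (t x y : R) : R :=
  derive1 (fun s => phi s x y) t.
Definition dx (phi : R -> R -> R -> R) (t x y : R) : R :=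
  derive1 (fun s => phi t s y) x.
Definition dy (phi : R -> R -> R -> R) (t x y : R) : R :=
  derive1 (fun s => phi t x s) y.

Definition continuous3 (phi : R -> R -> R -> R) : Prop :=
  continuous (fun q : (R * (R * R))%type => phi q.1 q.2.1 q.2.2).

(* C^1 functions whose restriction to times t >= 0 has compact support in
   [0,T) x C; the value at t = 0 is unconstrained. *)
Definition test_function (T : R) (phi : R -> R -> R -> R) : Prop :=
  [/\ forall t x y, [/\ derivable (fun s => phi s x y) t 1,
                        derivable (fun s => phi t s y) x 1 &
                        derivable (fun s => phi t x s) y 1],
      continuous3 phi,
      [/\ continuous3 (dt phi), continuous3 (dx phi) & continuous3 (dy phi)] &
      exists2 b : R, b < T &
      exists A : R, forall t x y,
        phi t x y != 0 -> [/\ t <= b, `|x| <= A & `|y| <= A]].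

(* (v . grad) phi, with v = (Re v, Im v) *)
Definition advect (v : R -> R[i] -> R[i]) (phi : R -> R -> R -> R)
    (t x y : R) : R :=
  complex.Re (v t (x +i* y)) * dx phi t x y +
  complex.Im (v t (x +i* y)) * dy phi t x y.

Definition div_free (T : R) (v : R -> R[i] -> R[i]) : Prop :=
  forall phi, test_function T phi ->
    Rintegral leb3 (slab T) (fun q => advect v phi q.1 q.2.1 q.2.2) = 0.

(* d/dt w + (v . grad) w = 0 and w(0, .) = w0, in the sense of distributions
   on [0,T) x C (for a divergence-free v). *)
Definition weak_transport (T : R) (v : R -> R[i] -> R[i]) (w0 : R[i] -> R[i])
    (w : R -> R[i] -> R[i]) : Prop :=
  forall phi, test_function T phi ->
    cintegral leb3 (slab T) (fun q =>
      w q.1 (cplx q.2) *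
      (dt phi q.1 q.2.1 q.2.2 + advect v phi q.1 q.2.1 q.2.2)%:C)
    + cintegral leb2 setT (fun p => w0 (cplx p) * (phi 0 p.1 p.2)%:C) = 0.

Definition euler_solution (T : R) (w0 : R[i] -> R[i])
    (w : R -> R[i] -> R[i]) : Prop :=
  [/\ LinftyLinfty T w,
      BS_convergent T w,
      div_free T (velocity w) &
      weak_transport T (velocity w) w0 w].

Definition Yudovich_solution (T : R) (w0 : R[i] -> R[i])
    (w : R -> R[i] -> R[i]) : Prop :=
  euler_solution T w0 w /\
  forall w', euler_solution T w0 w' ->
    {ae leb3, forall q, slab T q -> w' q.1 (cplx q.2) = w q.1 (cplx q.2)}.

(* d/dt X(t,z) = v(t, X(t,z)), X(0,z) = z on [0,T].  As v(t, .) is determined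
   only for almost every t, the equation is understood in Caratheodory's
   sense, i.e. in integrated form. *)
Definition is_flow (T : R) (v X : R -> R[i] -> R[i]) : Prop :=
  forall z : R[i],
    cintegrable leb1 `[0, T] (fun s => v s (X s z)) /\
    forall t, t \in `[0, T] ->
      X t z = z + cintegral leb1 `[0, t] (fun s => v s (X s z)).

(* u is a continuous choice of arg (g s) for s in D, where g avoids 0. *)
Definition arg_lift (D : set R) (g : R -> R[i]) (u : R -> R) : Prop :=
  {within D, continuous u} /\
  forall s, D s -> g s != 0 /\ g s = (cmod (g s))%:C * cis (u s).

(* a is the value at z = r e^{i theta} of the argument of f, continued from
   arg (f 1) = 0 along the unit circle from 1 to e^{i theta}, and then along
   the radius from e^{i theta} to z.  Since continuous lifts are unique, there
   is at most one such a when f 1 > 0. *)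
Definition continued_arg (f : R[i] -> R[i]) (z : R[i]) (a : R) : Prop :=
  exists r theta : R, exists u1 u2 : R -> R,
    [/\ [/\ 0 < r < 1, 0 <= theta < 2 * pi & z = r%:C * cis theta],
        arg_lift `[0, theta] (fun s => f (cis s)) u1 /\ u1 0 = 0,
        arg_lift `[r, 1] (fun s => f (s%:C * cis theta)) u2 /\
          u2 1 = u1 theta &
        a = u2 r].

End Defs.

(* Main.v *)
(** The velocity is log-Lipschitz: for almost every time r and all points z, w of a
    fixed disc,
      |v(r,z) - v(r,w)| <= c |z - w| (M (A - ln |z - w|) + b(r)),
    where M bounds the vorticity and b, integrable in time, comes from the vorticity
    far away.  Put D_t(y) = X_t(y) - X_t(0).  Osgood's argument gives
    A - ln |D_t(y)| <= c (A - ln |y|), hence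
      |d/dt D_t(y)| / |D_t(y)| <= c (M (A - ln |y|) + b(t)),
    and the argument of D_t(y), continued in time from that of D_0(y) = y, moves by
    at most c (1 + M t ln (1/|z|)) as long as |z| <= |y| <= 1.  Adding this rotation
    to the argument of y gives a continuous argument of D_t along any path from 1 to
    z in that annulus.  Finally M <= k ||omega_0||: if omega_0 = 0 then omega = 0 by
    uniqueness, and otherwise k may depend on the solution.  Since exp x >= 1 + x,
    the resulting bound, linear in t ||omega_0|| ln (1/|z|), is stronger than the
    claimed one. *)
Require Import Defs.
From HB Require Import structures.
From mathcomp Require Import all_boot all_order all_algebra.
From mathcomp Require Import complex.
From mathcomp Require Import all_classical all_reals all_analysis.
From mathcomp Require Import measurable_realfun ess_sup_inf.
From mathcomp Require Import ring lra.
Import Order.TTheory GRing.Theory Num.Theory.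
Import numFieldNormedType.Exports.
Local Open Scope classical_set_scope.
Local Open Scope complex_scope.
Local Open Scope ring_scope.

Set Implicit Arguments.
Unset Strict Implicit.
Unset Printing Implicit Defensive.

(** * The modulus and the argument of a complex number *)

(** The velocity is controlled only for almost every time, so the flow is never differentiated in
    time: each differential inequality becomes a bound on increments against a nondecreasing,
    uniformly continuous weight, proved on short time intervals and propagated by real induction.
    Gronwall, Osgood and the rotation all follow this scheme. The argument is lifted in time and not
    in space. An annulus is not simply connected, so arg D_t(y) is not a function of y; the angle
    gained between y and D_t(y) is one, because it starts from 0 for every y and changes by small
    well-defined amounts. Paths enter only at the end, through the argument of y itself. Continuity
    of X_t in space is not part of the definition of a flow: it comes from Osgood's estimate,
    uniformly in time. *)

Section ComplexModulus.
Context {R : realType}.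
Implicit Types (z w : R[i]) (x : R).

Lemma cmodE z : cmod z = Num.sqrt (complex.Re z ^+ 2 + complex.Im z ^+ 2).
Proof. by case: z. Qed.

Lemma cmod_ge0 z : 0 <= cmod z.
Proof. by rewrite cmodE sqrtr_ge0. Qed.

Lemma cmod_sqr z : cmod z ^+ 2 = complex.Re z ^+ 2 + complex.Im z ^+ 2.
Proof. by rewrite cmodE sqr_sqrtr// addr_ge0// sqr_ge0. Qed.

Lemma cmod0 : cmod (0 : R[i]) = 0.
Proof. exact: ComplexField.Normc.normc0. Qed.

Lemma cmod1 : cmod (1 : R[i]) = 1.
Proof. exact: ComplexField.Normc.normc1. Qed.

Lemma cmodM z w : cmod (z * w) = cmod z * cmod w.
Proof. exact: ComplexField.Normc.normcM. Qed.

Lemma cmodV z : cmod z^-1 = (cmod z)^-1.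
Proof. exact: ComplexField.Normc.normcV. Qed.

Lemma cmodN z : cmod (- z) = cmod z.
Proof. by rewrite !cmodE !raddfN !sqrrN. Qed.

Lemma cmodBC z w : cmod (z - w) = cmod (w - z).
Proof. by rewrite -cmodN opprB. Qed.

Lemma cmodD z w : cmod (z + w) <= cmod z + cmod w.
Proof. exact: le_normcD. Qed.

Lemma cmodB z w : cmod (z - w) <= cmod z + cmod w.
Proof. by rewrite -(cmodN w) cmodD. Qed.

Lemma cmodC x : cmod x%:C = `|x|.
Proof. by rewrite cmodE/= expr0n addr0 sqrtr_sqr. Qed.

Lemma cmod_eq0 z : (cmod z == 0) = (z == 0).
Proof.
apply/eqP/eqP => [|->]; last exact: cmod0.
exact: ComplexField.Normc.eq0_normc.
Qed.

Lemma cmod_gt0 z : (0 < cmod z) = (z != 0).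
Proof. by rewrite lt_def cmod_ge0 andbT cmod_eq0. Qed.

Lemma normr_Re z : `|complex.Re z| <= cmod z.
Proof. by rewrite -sqrtr_sqr cmodE ler_wsqrtr// lerDl sqr_ge0. Qed.

Lemma normr_Im z : `|complex.Im z| <= cmod z.
Proof. by rewrite -sqrtr_sqr cmodE ler_wsqrtr// lerDr sqr_ge0. Qed.

Lemma cmod_le z : cmod z <= `|complex.Re z| + `|complex.Im z|.
Proof.
have h : 0 <= `|complex.Re z| + `|complex.Im z| by rewrite addr_ge0.
rewrite cmodE -(ler_sqr (sqrtr_ge0 _) h) sqr_sqrtr ?addr_ge0 ?sqr_ge0//.
rewrite sqrrD !real_normK ?num_real// lerD2r lerDl.
by rewrite mulrn_wge0// mulr_ge0.
Qed.

Lemma cmodJ z : cmod z^*%C = cmod z.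
Proof. by case: z => a b; rewrite !cmodE/= sqrrN. Qed.

Lemma mulcJE z : z * z^*%C = (cmod z ^+ 2)%:C.
Proof.
rewrite cmod_sqr; case: z => a b; apply/eqP; rewrite eq_complex/=.
by apply/andP; split; apply/eqP; ring.
Qed.

Lemma cmod_cis x : cmod (cis x) = 1.
Proof. by rewrite cmodE/= cos2Dsin2 sqrtr1. Qed.

Lemma cisD (x y : R) : cis (x + y) = cis x * cis y.
Proof.
rewrite /cis cosD sinD; apply/eqP; rewrite eq_complex/= eqxx/=.
by apply/eqP; rewrite addrC; congr (_ + _); rewrite mulrC.
Qed.

Lemma cis0 : cis 0 = 1 :> R[i].
Proof. by rewrite /cis cos0 sin0. Qed.

Lemma cis_neq0 x : cis x != 0.
Proof. by rewrite -cmod_gt0 cmod_cis. Qed.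

Lemma cisN x : cis (- x) = (cis x)^-1.
Proof.
by apply: (mulfI (cis_neq0 x)); rewrite -cisD subrr cis0 divff// cis_neq0.
Qed.

(** In the right half plane the argument is atan (Im / Re): continuous, and at most |Im| / Re in
    size. Both facts are used to measure one short step of rotation. *)
Lemma cis_atan_right_half_plane z : 0 < complex.Re z ->
  z = (cmod z)%:C * cis (atan (complex.Im z / complex.Re z)).
Proof.
case: z => x y /= x0.
set w := y / x.
have sin_atan : sin (atan w) = w * cos (atan w).
  rewrite -{2}(atanK w) /tan mulfVK// cos_atan invr_eq0.
  by rewrite gt_eqF// sqrtr_gt0 ltr_wpDr// sqr_ge0.
rewrite /cis sin_atan cos_atan.
set q := Num.sqrt (1 + _).
have -> : Num.sqrt (x ^+ 2 + y ^+ 2) = x * q.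
  rewrite -[X in X * q](gtr0_norm x0) -sqrtr_sqr /q -sqrtrM ?sqr_ge0//.
  by congr Num.sqrt; rewrite /w; field; rewrite gt_eqF.
have q0 : q != 0.
  by rewrite gt_eqF// sqrtr_gt0 ltr_wpDr// ?sqr_ge0.
apply/eqP; rewrite eq_complex/= !mul0r !subr0 !addr0.
apply/andP; split; apply/eqP; rewrite /w; field; rewrite ?q0 ?gt_eqF//.
Qed.

Lemma normr_atan_le x : `|atan x| <= `|x|.
Proof.
wlog x0 : x / 0 <= x.
  move=> h; have [/h//|/ltW x0] := leP 0 x.
  by rewrite -normrN -[leRHS]normrN -atanN h// oppr_ge0.
move: x0; rewrite le_eqVlt => /predU1P[<-|x0]; first by rewrite atan0.
have dat y : y \in `]0, x[ -> is_derive y 1 (@atan R) (1 + y ^+ 2)^-1.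
  by move=> _; exact: is_derive1_atan.
have cat : {within `[0, x], continuous (@atan R)}.
  by apply: continuous_subspaceT => y; exact: continuous_atan.
have [c _] := MVT x0 dat cat.
rewrite atan0 !subr0 => ->; rewrite normrM ler_piMl//.
rewrite ger0_norm ?invr_ge0 ?addr_ge0 ?sqr_ge0//.
by rewrite invf_le1 ?lerDl ?sqr_ge0// ltr_wpDr// sqr_ge0.
Qed.

End ComplexModulus.

Section PolarForm.
Context {R : realType}.

Lemma polar_form (z : R[i]) : z != 0 ->
  exists2 theta : R, 0 <= theta < 2 * pi & z = (cmod z)%:C * cis theta.
Proof.
move=> z0; set r := cmod z.
have r0 : 0 < r by rewrite cmod_gt0.
have rn0 : r != 0 by rewrite gt_eqF.
pose x := complex.Re z / r; pose y := complex.Im z / r.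
have xy1 : x ^+ 2 + y ^+ 2 = 1.
  by rewrite !expr_div_n -mulrDl -cmod_sqr divff// expf_neq0.
have x1 : -1 <= x <= 1.
  by rewrite -ler_norml -(expr_le1 (n := 2))// real_normK ?num_real// -xy1 lerDl sqr_ge0.
have zE : z = r%:C * (x +i* y).
  rewrite [LHS]complexE; apply/eqP; rewrite eq_complex/= !mul0r !subr0 !add0r.
  by rewrite !mulr0 !mul1r !addr0 subr0 /x /y !(mulrC r) !divfK// !eqxx.
have siny : sin (acos x) = `|y|.
  by rewrite sin_acos// -xy1 addrAC subrr add0r sqrtr_sqr.
have [y0|y0] := leP 0 y.
  exists (acos x).
    rewrite acos_ge0//= (le_lt_trans (acos_lepi x1))//.
    by rewrite ltr_pMl ?pi_gt0// ltr1n.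
  by rewrite /cis acosK// siny ger0_norm.
exists (2 * pi - acos x).
  (* Strict, so that theta < 2 pi: acos x = 0 would give |y| = sin 0 = 0, against y < 0. *)
  have a0 : 0 < acos x.
    rewrite lt_neqAle acos_ge0// andbT; apply/eqP => /esym h.
    by move: siny; rewrite h sin0 => /esym/eqP; rewrite normr_eq0 lt_eqF.
  rewrite ltrBlDr ltrDl a0 andbT subr_ge0 (le_trans (acos_lepi x1))//.
  by rewrite ler_pMl ?pi_gt0// ler1n.
have -> : 2 * pi - acos x = - acos x + pi *+ 2 by rewrite mulr_natl addrC.
by rewrite /cis cosD2pi sinD2pi cosN sinN acosK// siny ltr0_norm// opprK.
Qed.

End PolarForm.

(** * Gronwall and Osgood inequalities in integrated form *)

Section RealInduction.
Context {R : realType}.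

(** The step speaks of pairs s <= s' near s0, on either side of it, so a single hypothesis gives
    both passage to the supremum from below and extension beyond it. *)
Lemma real_induction (P : R -> Prop) (t : R) : 0 <= t -> P 0 ->
  (forall s0 : R, 0 <= s0 <= t -> exists2 e : R, 0 < e &
    forall s s' : R, 0 <= s -> s <= s' -> s' <= t ->
      `|s - s0| < e -> `|s' - s0| < e -> P s -> P s') ->
  forall s : R, 0 <= s <= t -> P s.
Proof.
move=> t0 P0 step s1 /andP[s10 s1t].
pose S := [set s | 0 <= s <= s1 /\ P s].
have S0 : S 0 by split; rewrite ?lexx.
have ubS : ubound S s1 by move=> x [/andP[]].
have hS : has_sup S by split; [exists 0|exists s1].
have sup0 : 0 <= sup S by apply: ub_le_sup => //; exists s1.
have sup1 : sup S <= s1 by apply: ge_sup => //; exists 0.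
have [|e e0 he] := step (sup S); first by rewrite sup0 (le_trans sup1).
have [x Sx ex] := sup_adherent e0 hS.
have xs : x <= sup S by apply: ub_le_sup => //; exists s1.
case: Sx => /andP[x0 xs1] Px.
(* Past the supremum unless cut off at [s1]; as P y holds, only the cut-off can occur. *)
pose y := Num.min s1 (sup S + e / 2).
have e2 : e / 2 < e by rewrite ltr_pdivrMr// ltr_pMr// ltr1n.
have e20 : 0 < e / 2 by rewrite divr_gt0.
have yl : sup S <= y by rewrite /y le_min sup1 lerDl ltW.
have ys1 : y <= s1 by rewrite /y ge_min lexx.
have yu : y <= sup S + e / 2 by rewrite /y ge_min lexx orbT.
have Py : P y.
  apply: he Px => //; first exact: le_trans xs yl.
  - exact: le_trans s1t.
  - rewrite ler0_norm ?subr_le0// opprB ltrBlDr -ltrBlDl//.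
  - by rewrite ger0_norm ?subr_ge0// ltrBlDl (le_lt_trans yu)// ltrD2l.
have Sy : S y by split => //; rewrite ys1 andbT (le_trans sup0).
have ysup : y <= sup S by apply: ub_le_sup => //; exists s1.
have [h|h] := leP s1 (sup S + e / 2).
  by rewrite -(_ : y = s1)// /y min_l.
by move: ysup; rewrite /y min_r ?(ltW h)// gerDl leNgt e20.
Qed.

End RealInduction.

Section Gronwall.
Context {R : realType}.

(** The supremum of f satisfies sup <= f s + sup / 2, and the right-hand sup is absorbed. The a
    priori bound [K] only makes it finite. *)
Lemma sup_absorb (f : R -> R) (s s' g K : R) : g <= 1 / 2 ->
  (forall u : R, s <= u <= s' -> 0 <= f u <= K) ->
  (forall S v : R, s <= v <= s' -> (forall u : R, s <= u <= v -> f u <= S) ->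
     f v <= f s + S * g) ->
  forall u : R, s <= u <= s' -> f u <= 2 * f s.
Proof.
move=> g2 fK fS u0 /andP[su0 u0s'].
have ss' : s <= s' by exact: le_trans u0s'.
have /fK/andP[fs _] : s <= s <= s' by rewrite lexx.
pose E := [set f u | u in [set u | s <= u <= s']].
have Es : E (f s) by exists s => //=; rewrite lexx.
have ubE : has_ubound E by exists K => _ [u /= /fK/andP[_ ?] <-].
have leE u : s <= u <= s' -> f u <= sup E.
  by move=> us; apply: ub_le_sup => //; exists u.
suff : sup E <= 2 * f s by apply: le_trans; apply: leE; rewrite su0.
have : sup E <= f s + sup E * g.
  apply: ge_sup; first by exists (f s).
  move=> _ [u /= /andP[su us'] <-]; apply: fS => [|v /andP[sv vu]].
    by rewrite su.
  by rewrite leE// sv (le_trans vu).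
have : sup E * g <= sup E * (1 / 2).
  by rewrite ler_wpM2l// (le_trans fs)// leE// lexx.
lra.
Qed.

(** On an interval where H grows by less than 1/2, [sup_absorb] gives f <= 2 f(s), hence f(s') <=
    f(s) (1 + 2 dH) <= f(s) exp (2 dH). This doubling is the 2 in the exponent. *)
Lemma gronwall (f H : R -> R) (t K : R) : 0 <= t ->
  (forall s : R, 0 <= s <= t -> 0 <= f s <= K) ->
  (forall s s' : R, 0 <= s -> s <= s' -> s' <= t -> H s <= H s') ->
  (forall e : R, 0 < e -> exists2 d : R, 0 < d &
    forall s s' : R, 0 <= s -> s <= s' -> s' <= t -> s' - s < d ->
      H s' - H s < e) ->
  (forall s s' S : R, 0 <= s -> s <= s' -> s' <= t ->
    (forall u : R, s <= u <= s' -> f u <= S) ->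
    f s' <= f s + S * (H s' - H s)) ->
  forall s : R, 0 <= s <= t -> f s <= f 0 * expR (2 * (H s - H 0)).
Proof.
move=> t0 fK Hnd Huc fS; apply: real_induction => //.
  by rewrite subrr mulr0 expR0 mulr1.
move=> s0 s0t; have [|d d0 hd] := Huc (1 / 2); first by rewrite divr_gt0.
exists (d / 2); first by rewrite divr_gt0.
move=> s s' s0' ss' s't sd s'd fs.
have g2 : H s' - H s < 1 / 2.
  apply: hd => //; move: sd s'd; rewrite !ltr_norml => /andP[? ?] /andP[? ?]; lra.
have K' u : s <= u <= s' -> 0 <= f u <= K.
  by move=> /andP[su us']; apply: fK; rewrite (le_trans s0' su) (le_trans us').
have /K'/andP[fs0 _] : s <= s <= s' by rewrite lexx.
have f2 : forall u, s <= u <= s' -> f u <= 2 * f s.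
  apply: (sup_absorb (ltW g2) K') => S v /andP[sv vs'] hS.
  have S0 : 0 <= S by apply: le_trans fs0 (hS s _); rewrite lexx.
  apply: le_trans (fS s v S s0' sv _ hS) _; first exact: le_trans s't.
  by rewrite lerD2l ler_wpM2l// lerD2r Hnd// (le_trans s0').
apply: le_trans (fS _ _ _ s0' ss' s't f2) _.
have -> : 2 * (H s' - H 0) = 2 * (H s - H 0) + 2 * (H s' - H s) by ring.
rewrite expRD mulrA; apply: (@le_trans _ _ (f s * expR (2 * (H s' - H s)))).
  have -> : f s + 2 * f s * (H s' - H s) = f s * (1 + 2 * (H s' - H s)) by ring.
  by rewrite ler_wpM2l ?expR_ge1Dx.
by rewrite ler_wpM2r// expR_ge0.
Qed.

End Gronwall.

Section Osgood.
Context {R : realType}.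
Variables (A t : R) (rho H : R -> R).

Local Notation Lam x := (A - ln x).

Hypothesis t0 : 0 <= t.
Hypothesis rho_ge0 : forall s : R, 0 <= s <= t -> 0 <= rho s.
Hypothesis Lam_ge1 : forall s : R, 0 <= s <= t -> 1 <= Lam (rho s).
Hypothesis H_nd : forall s s' : R, 0 <= s -> s <= s' -> s' <= t -> H s <= H s'.
Hypothesis H_uc : forall e : R, 0 < e -> exists2 d : R, 0 < d &
  forall s s' : R, 0 <= s -> s <= s' -> s' <= t -> s' - s < d -> H s' - H s < e.
Hypothesis rho_osgood : forall s s' S : R, 0 <= s -> s <= s' -> s' <= t ->
  (forall r : R, s <= r <= s' -> rho r * Lam (rho r) <= S) ->
  `|rho s' - rho s| <= S * (H s' - H s).

Lemma ln_leB1 (x : R) : 0 < x -> ln x <= x - 1.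
Proof. by move=> x0; rewrite -{1}(subrK 1 x) addrC le_ln1Dx// ltrBrDr addNr. Qed.

(** [expR (A - 1)] is the maximum of x (A - ln x), attained at x = exp (A - 1). *)
Lemma mul_ALn_le (x : R) : 0 <= x -> x * Lam x <= expR (A - 1).
Proof.
rewrite le_eqVlt => /predU1P[<-|x0]; first by rewrite mul0r expR_ge0.
have -> : Lam x = 1 + ln (expR (A - 1) / x).
  by rewrite ln_div ?posrE ?expR_gt0// expRK; ring.
have h : ln (expR (A - 1) / x) <= expR (A - 1) / x - 1.
  by rewrite ln_leB1// divr_gt0// expR_gt0.
rewrite (le_trans (ler_wpM2l (ltW x0) (_ : _ <= expR (A - 1) / x)))//.
  by rewrite addrC -lerBrDr.
by rewrite mulrCA divff ?mulr1// gt_eqF.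
Qed.

(** The Osgood modulus is bounded by [mul_ALn_le], so rho inherits the uniform continuity of H even
    before it is known to stay positive. *)
Lemma osgood_continuous (s0 : R) : 0 <= s0 <= t -> forall e : R, 0 < e ->
  exists2 d : R, 0 < d & forall s : R, 0 <= s <= t -> `|s - s0| < d ->
    `|rho s - rho s0| < e.
Proof.
move=> /andP[s00 s0t] e e0.
have E0 : 0 < expR (A - 1) by rewrite expR_gt0.
have [d d0 hd] := H_uc (divr_gt0 e0 E0).
exists d => // s /andP[sge0 st].
wlog : s s0 s00 s0t sge0 st / s0 <= s.
  move=> h hs; have [ss|/ltW ss] := leP s0 s; first exact: h.
  by rewrite distrC h// distrC.
move=> s0s; rewrite ger0_norm ?subr_ge0// => ssd.
apply: le_lt_trans (rho_osgood (S := expR (A - 1)) s00 s0s st _) _.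
  move=> r /andP[r1 r2]; apply/mul_ALn_le/rho_ge0.
  by rewrite (le_trans s00)//= (le_trans r2).
by rewrite mulrC -ltr_pdivlMr// hd.
Qed.

Lemma dist_ln_le (x y m : R) : 0 < m -> m <= x -> m <= y ->
  `|ln x - ln y| <= `|x - y| / m.
Proof.
wlog yx : x y / y <= x.
  move=> h m0 mx my; have [/h|/ltW/h] := leP y x; first exact.
  by rewrite distrC (distrC x); exact.
move=> m0 mx my; have y0 := lt_le_trans m0 my; have x0 := lt_le_trans m0 mx.
rewrite !ger0_norm ?subr_ge0 ?ler_ln ?posrE//.
rewrite -ln_div ?posrE//.
have /(le_trans _) -> // : x / y - 1 <= (x - y) / m.
  rewrite -[X in _ - X](divff (lt0r_neq0 y0)) -mulrBl.
  by rewrite ler_wpM2l ?subr_ge0// lef_pV2.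
by rewrite ln_leB1// divr_gt0.
Qed.

(* Up to sign, ln (A - ln x) is a primitive of 1 / (x (A - ln x)). *)
Lemma osgood (s : R) : 0 <= s <= t -> 0 < rho 0 ->
  0 < rho s /\ `|ln (Lam (rho s)) - ln (Lam (rho 0))| <= 16 * (H s - H 0).
Proof.
move=> st rho0.
have Lam0 u : 0 <= u <= t -> 0 < Lam (rho u).
  by move=> /Lam_ge1; exact: lt_le_trans.
pose P s := 0 < rho s /\
  `|ln (Lam (rho s)) - ln (Lam (rho 0))| <= 16 * (H s - H 0).
apply: (@real_induction _ P t) st => //.
  by split => //; rewrite !subrr normr0 mulr0.
move=> s0 s0t.
have := rho_ge0 s0t; rewrite le_eqVlt => /predU1P[/esym rs0|rs0].
  (* The lower bound for rho that the estimate at an earlier time [u] enforces, uniformly up to t;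
     rho therefore cannot vanish at [s0]. *)
  pose m := expR (A - expR (16 * (H t - H 0)) * Lam (rho 0)).
  have m0 : 0 < m by rewrite expR_gt0.
  have [d d0 hd] := osgood_continuous s0t m0.
  exists d => // u u' u0 uu' u't ud _ [ru hu]; exfalso.
  have ut : 0 <= u <= t by rewrite u0 (le_trans uu').
  move: (hd _ ut ud); rewrite rs0 subr0 gtr0_norm// ltNge => /negP; apply.
  rewrite -ler_ln ?posrE// expRK lerBlDr -lerBlDl.
  rewrite -ler_ln ?posrE ?Lam0// ?mulr_gt0 ?expR_gt0 ?Lam0 ?lexx//.
  rewrite lnM ?posrE ?expR_gt0 ?Lam0 ?lexx// expRK -lerBlDr.
  rewrite (le_trans (ler_norm _))// (le_trans hu)// ler_wpM2l// lerD2r.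
  by rewrite H_nd//; case/andP: ut.
have rs2 : 0 < rho s0 / 2 by rewrite divr_gt0.
have [d d0 hd] := osgood_continuous s0t rs2.
have bd r : 0 <= r <= t -> `|r - s0| < d -> rho s0 / 2 <= rho r <= 2 * rho s0.
  move=> rt /(hd _ rt) /ltW; rewrite ler_norml => /andP[h1 h2].
  by apply/andP; split; lra.
set L0 := Lam (rho s0).
have L01 : 1 <= L0 by exact: Lam_ge1.
have ln2 : ln 2 <= 1 :> R.
  by have := @ln_leB1 2; rewrite ltr0n => /(_ isT); lra.
exists d => // u u' u0 uu' u't ud u'd [ru hu].
have ut : 0 <= u <= t by rewrite u0 (le_trans uu').
have u't' : 0 <= u' <= t by rewrite u't andbT (le_trans u0).
have /andP[bu1 bu2] := bd _ ut ud.
have /andP[bu'1 bu'2] := bd _ u't' u'd.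
have ru' : 0 < rho u' by exact: lt_le_trans bu'1.
split=> //.
have dH : 0 <= H u' - H u by rewrite subr_ge0 H_nd.
(* Origin of 16: near [s0], rho <= 2 rho(s0) and Lam <= 2 [L0] give 4; dividing by rho >= rho(s0) /
   2 gives 8 for ln rho; dividing by Lam >= [L0] / 2 gives 16 for ln Lam. *)
have drho : `|rho u' - rho u| <= 4 * rho s0 * L0 * (H u' - H u).
  apply: rho_osgood => // r /andP[ur ru'0].
  have rt : 0 <= r <= t by rewrite (le_trans u0 ur) (le_trans ru'0 u't).
  have rd : `|r - s0| < d.
    by move: ud u'd; rewrite !ltr_norml => /andP[? ?] /andP[? ?]; lra.
  have /andP[br1 br2] := bd _ rt rd.
  have rr : 0 < rho r by exact: lt_le_trans br1.
  have : Lam (rho r) <= 2 * L0.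
    have : ln (rho s0 / 2) <= ln (rho r) by rewrite ler_ln ?posrE.
    rewrite ln_div ?posrE// => h; rewrite /= /L0; move: L01; rewrite /L0; lra.
  move=> /(ler_pM (ltW rr) (ltW (Lam0 _ rt)) br2) /le_trans; apply.
  by rewrite mulrACA -!mulrA; lra.
have dln : `|ln (rho u') - ln (rho u)| <= 8 * L0 * (H u' - H u).
  apply: le_trans (dist_ln_le rs2 bu'1 bu1) _.
  rewrite ler_pdivrMr// (le_trans drho)//.
  suff -> : 4 * rho s0 * L0 * (H u' - H u) = 8 * L0 * (H u' - H u) * (rho s0 / 2) by [].
  by field.
(* Lam (rho r) is at least [L0] - ln 2 >= [L0] - 1 and at least 1, hence at least their mean. *)
have Lm r : 0 <= r <= t -> `|r - s0| < d -> L0 / 2 <= Lam (rho r).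
  move=> rt rd; have /andP[br1 br2] := bd _ rt rd.
  have rr : 0 < rho r by exact: lt_le_trans br1.
  have : ln (rho r) <= ln (2 * rho s0) by rewrite ler_ln ?posrE// mulr_gt0.
  rewrite lnM ?posrE//; have := Lam_ge1 rt; rewrite /L0 /=; lra.
have dlam : `|ln (Lam (rho u')) - ln (Lam (rho u))| <= 16 * (H u' - H u).
  apply: le_trans (dist_ln_le (m := L0 / 2) _ (Lm _ u't' u'd) (Lm _ ut ud)) _.
    by rewrite divr_gt0// (lt_le_trans _ L01).
  rewrite ler_pdivrMr ?divr_gt0// ?(lt_le_trans _ L01)//.
  have -> : A - ln (rho u') - (A - ln (rho u)) = ln (rho u) - ln (rho u') by ring.
  by rewrite distrC (le_trans dln)// le_eqVlt; apply/orP; left; apply/eqP; field.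
have -> : 16 * (H u' - H 0) = 16 * (H u' - H u) + 16 * (H u - H 0) by ring.
apply: le_trans (lerD dlam hu).
rewrite -[X in `|X| <= _](_ : (ln (Lam (rho u')) - ln (Lam (rho u))) +
  (ln (Lam (rho u)) - ln (Lam (rho 0))) = _) ?ler_normD//.
by ring.
Qed.

End Osgood.

(** * Rotation of a flow satisfying an Osgood condition *)

Section FlowRotation.
Context {R : realType}.
Variables (T A M : R) (Bint : R -> R) (X : R -> R[i] -> R[i]).

Local Notation Lam x := (A - ln x).
Let rho (y y' : R[i]) (s : R) := cmod (X s y - X s y').
Let D (s : R) (y : R[i]) := X s y - X s 0.

Hypothesis T0 : 0 <= T.
Hypothesis M0 : 0 <= M.
Hypothesis X0 : forall y, X 0 y = y.
Hypothesis Bint_nd : forall s s' : R,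
  0 <= s -> s <= s' -> s' <= T -> Bint s <= Bint s'.
Hypothesis Bint_uc : forall e : R, 0 < e -> exists2 d : R, 0 < d &
  forall s s' : R, 0 <= s -> s <= s' -> s' <= T -> s' - s < d ->
    Bint s' - Bint s < e.
Hypothesis Lam_ge1 : forall (y y' : R[i]) (s : R),
  cmod y <= 1 -> cmod y' <= 1 -> 0 <= s <= T -> 1 <= Lam (rho y y' s).
(* Two separate bounds S1 and S2, since Bint t need not be O(t) as t tends to 0: the
   logarithmic factor must multiply the elapsed time only. *)
Hypothesis core : forall (y y' : R[i]) (s s' S1 S2 : R),
  cmod y <= 1 -> cmod y' <= 1 -> 0 <= s -> s <= s' -> s' <= T ->
  (forall r : R, s <= r <= s' ->
     rho y y' r * Lam (rho y y' r) <= S1 /\ rho y y' r <= S2) ->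
  cmod ((X s' y - X s' y') - (X s y - X s y')) <=
    M * S1 * (s' - s) + S2 * (Bint s' - Bint s).

(** [L] stands for the logarithmic factor. It is 1 for Osgood's argument, which keeps that factor in
    the modulus, and a bound on Lam along trajectories for the rotation. *)
Let time_weight (L s : R) := M * L * s + Bint s.

Lemma time_weight_nd L (s s' : R) : 0 <= L ->
  0 <= s -> s <= s' -> s' <= T -> time_weight L s <= time_weight L s'.
Proof.
by move=> L0 s0 ss sT; rewrite lerD ?Bint_nd// ler_wpM2l// mulr_ge0.
Qed.

Lemma time_weight_uc L (e : R) : 0 <= L -> 0 < e -> exists2 d : R, 0 < d &
  forall s s' : R, 0 <= s -> s <= s' -> s' <= T -> s' - s < d ->
    time_weight L s' - time_weight L s < e.
Proof.
move=> L0 e0; have e20 : 0 < e / 2 by rewrite divr_gt0.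
have [d d0 hd] := Bint_uc e20.
have ML : 0 <= M * L by rewrite mulr_ge0.
have ML1 : 0 < M * L + 1 by rewrite ltr_wpDl.
exists (Num.min d (e / 2 / (M * L + 1))).
  by rewrite lt_min d0 divr_gt0.
move=> s s' s0 ss sT; rewrite lt_min => /andP[/hd h].
rewrite ltr_pdivlMr// => h2; have {}h := h s0 ss sT.
have : M * L * (s' - s) <= (s' - s) * (M * L + 1).
  by rewrite mulrC ler_wpM2l ?subr_ge0// lerDl.
rewrite /time_weight; lra.
Qed.

(** Osgood's bound over all of [0, T], so that one factor [expR h] serves every time and every pair
    of points. *)
Let h := 16 * (time_weight 1 T - time_weight 1 0).

Let h_ge0 : 0 <= h.
Proof. by rewrite mulr_ge0// subr_ge0 time_weight_nd. Qed.

Lemma flow_osgood y y' (s : R) : cmod y <= 1 -> cmod y' <= 1 -> y != y' ->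
  0 <= s <= T ->
  0 < rho y y' s /\
  `|ln (Lam (rho y y' s)) - ln (Lam (cmod (y - y')))| <= h.
Proof.
move=> y1 y'1 yy' /andP[s0 sT].
have [||||||||r0 hr] := @osgood R A T (rho y y') (time_weight 1) _ _ _ _ _ _ s.
- exact: T0.
- by move=> u _; exact: cmod_ge0.
- by move=> u uT; exact: Lam_ge1.
- by move=> u v; exact: time_weight_nd.
- by move=> e; exact: time_weight_uc.
- move=> u v S u0 uv vT hS.
  apply: (@le_trans _ _ (cmod ((X v y - X v y') - (X u y - X u y')))).
    rewrite /rho -[X in cmod X - _](subrK (X u y - X u y')).
    move: (X u y - X u y') (X v y - X v y') => a b.
    have h1 := cmodD (b - a) a; have h2 := cmodD (a - b) b.
    rewrite !subrK in h1 h2 *; rewrite (cmodBC a) in h2.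
    by rewrite ler_norml; apply/andP; split; lra.
  (* As Lam >= 1, a bound on rho Lam also bounds rho, so the same S serves both parts. *)
  apply: (le_trans (core y1 y'1 u0 uv vT (S1 := S) (S2 := S) _)); last first.
    by rewrite le_eqVlt; apply/orP; left; apply/eqP; rewrite /time_weight; ring.
  move=> r ur; split; first exact: hS.
  apply: le_trans (hS _ ur); rewrite ler_peMr ?cmod_ge0//.
  by case/andP: ur => ur rv; apply: Lam_ge1; rewrite // (le_trans u0 ur) (le_trans rv).
- by rewrite s0.
- by rewrite /rho !X0 cmod_gt0 subr_eq0.
split=> //; move: hr; rewrite [in X in X -> _]/rho !X0 => /le_trans; apply.
by rewrite ler_wpM2l// lerD2r time_weight_nd.
Qed.

(** The lower bound prevents trajectories from spreading and yields equicontinuity; the upper one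
    prevents them from merging and bounds the logarithmic factor by its initial value. *)
Lemma flow_separation y y' (s : R) : cmod y <= 1 -> cmod y' <= 1 -> y != y' ->
  0 <= s <= T ->
  expR (- h) * Lam (cmod (y - y')) <= Lam (rho y y' s)
    <= expR h * Lam (cmod (y - y')).
Proof.
move=> y1 y'1 yy' sT; have [r0] := flow_osgood y1 y'1 yy' sT.
have L0 : 0 < Lam (cmod (y - y')).
  have := @Lam_ge1 y y' 0 y1 y'1; rewrite /rho !X0 lexx => /(_ T0).
  exact: lt_le_trans.
have Ls : 0 < Lam (rho y y' s) by exact: lt_le_trans (Lam_ge1 y1 y'1 sT).
rewrite ler_norml => /andP[h1 h2]; apply/andP; split.
  rewrite -ler_ln ?posrE ?mulr_gt0 ?expR_gt0//.
  by rewrite lnM ?posrE ?expR_gt0// expRK; lra.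
rewrite -ler_ln ?posrE ?mulr_gt0 ?expR_gt0//.
by rewrite lnM ?posrE ?expR_gt0// expRK; lra.
Qed.

Lemma flow_equicontinuous (e : R) : 0 < e -> exists2 d : R, 0 < d &
  forall y y' (s : R), cmod y <= 1 -> cmod y' <= 1 -> 0 <= s <= T ->
    cmod (y - y') < d -> rho y y' s < e.
Proof.
(* The solution d of exp (-h) (A - ln d) = A - ln e. *)
move=> e0; exists (expR (A - expR h * Lam e)) => [|y y' s y1 y'1 sT yd].
  exact: expR_gt0.
have [->|yy'] := eqVneq y y'; first by rewrite /rho subrr cmod0.
have [r0 _] := flow_osgood y1 y'1 yy' sT.
have /andP[h1 _] := flow_separation y1 y'1 yy' sT.
rewrite -ltr_ln ?posrE//.
have : ln (cmod (y - y')) < A - expR h * Lam e.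
  by rewrite -[ltRHS]expRK ltr_ln ?posrE ?expR_gt0// cmod_gt0 subr_eq0.
rewrite ltrBrDl -ltrBrDr => hL.
have : expR (- h) * (expR h * Lam e) < expR (- h) * Lam (cmod (y - y')).
  by rewrite ltr_pM2l ?expR_gt0.
rewrite mulrA -expRD addNr expR0 mul1r => /lt_le_trans/(_ h1).
by rewrite ltrD2l ltrN2.
Qed.

Local Notation pt p := ((p.1 : R) +i* (p.2 : R)).

Let annulus (r : R) : set (R * R)%type := [set p | r <= cmod (pt p) <= 1].

Lemma near_pt (p : R * R) (d : R) : 0 < d ->
  \forall q \near p, cmod (pt p - pt q) < d.
Proof.
move=> d0; have d20 : 0 < d / 2 by rewrite divr_gt0.
have h1 : \forall q \near p, `|p.1 - q.1| < d / 2.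
  have : q.1 @[q --> p] --> p.1 by exact: cvg_fst.
  by move=> /cvgrPdist_lt; exact.
have h2 : \forall q \near p, `|p.2 - q.2| < d / 2.
  have : q.2 @[q --> p] --> p.2 by exact: cvg_snd.
  by move=> /cvgrPdist_lt; exact.
near=> q; apply: le_lt_trans (cmod_le _) _ => /=.
rewrite (splitr d) ltrD//; first by near: q.
by near: q.
Unshelve. all: by end_near. Qed.

(** [f] is meant to be the real or the imaginary part; the term X_s(0) cancels in differences of
    D. *)
Lemma flow_cvg (f : R[i] -> R) (r : R) (p : R * R) (s : R) :
  (forall z w, `|f z - f w| <= cmod (z - w)) ->
  annulus r p -> 0 <= s <= T ->
  f (D s (pt q)) @[q --> within (annulus r) (nbhs p)] --> f (D s (pt p)).
Proof.
move=> hf /andP[rp p1] sT; apply/cvgrPdist_lt => e e0.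
have [d d0 hd] := flow_equicontinuous e0.
rewrite near_withinE; near=> q => /andP[_ q1].
apply: le_lt_trans (hf _ _) _.
have -> : D s (pt p) - D s (pt q) = X s (pt p) - X s (pt q).
  by rewrite /D opprB addrA subrK.
by apply: hd => //; near: q; exact: near_pt.
Unshelve. all: by end_near. Qed.

(** For |y| >= r, [flow_separation] bounds the logarithmic factor by [L] at all times, so the
    increment is linear in sup |D|; over a short time that sup is at most 2 |D_s(y)|. *)
Lemma flow_increment (r : R) (y : R[i]) (s s' : R) :
  let L := expR h * Lam r in
  0 < r -> r <= cmod y <= 1 -> 0 <= s -> s <= s' -> s' <= T ->
  time_weight L s' - time_weight L s <= 1 / 2 ->
  cmod (D s' y - D s y) <=
    2 * (time_weight L s' - time_weight L s) * cmod (D s y).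
Proof.
move=> L r0 /andP[ry y1] s0 ss' s'T; set g := time_weight L s' - _ => g2.
have y0 : y != 0 by rewrite -cmod_gt0 (lt_le_trans r0).
have c0 : cmod (0 : R[i]) <= 1 by rewrite cmod0.
have LamL u : 0 <= u <= T -> Lam (rho y 0 u) <= L.
  move=> uT; have /andP[_] := flow_separation y1 c0 y0 uT.
  move/le_trans; apply; rewrite subr0 ler_wpM2l ?expR_ge0// lerD2l lerN2.
  by rewrite ler_ln// posrE// (lt_le_trans r0).
have L0 : 0 <= L.
  apply: le_trans (LamL 0 _); rewrite ?lexx//.
  by rewrite (le_trans _ (Lam_ge1 _ _ _))// lexx.
have rho0 u : 0 <= rho y 0 u by exact: cmod_ge0.
have g0 : 0 <= g by rewrite subr_ge0 time_weight_nd.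
have inc (S v : R) : s <= v -> v <= s' ->
    (forall u, s <= u <= v -> rho y 0 u <= S) ->
    cmod (D v y - D s y) <= S * g.
  move=> sv vs' hS.
  have S0 : 0 <= S by rewrite (le_trans (rho0 s))// hS// lexx.
  have -> : D v y - D s y = (X v y - X v 0) - (X s y - X s 0) by [].
  apply: le_trans (core (S1 := S * L) (S2 := S) y1 c0 s0 sv _ _) _.
  - exact: le_trans s'T.
  - move=> u /andP[su uv]; rewrite hS ?su//; split=> //.
    have uT : 0 <= u <= T.
      by rewrite (le_trans s0 su) (le_trans uv)// (le_trans vs').
    rewrite ler_pM ?hS ?su ?LamL//.
    by rewrite (le_trans _ (Lam_ge1 _ _ _)).
  - have -> : M * (S * L) * (v - s) + S * (Bint v - Bint s) =
      S * (time_weight L v - time_weight L s) by rewrite /time_weight; ring.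
    by rewrite ler_wpM2l// lerD2r time_weight_nd// (le_trans s0).
have rho2 : forall u, s <= u <= s' -> rho y 0 u <= 2 * rho y 0 s.
  (* Lam >= 1 reads ln rho <= A - 1, which supplies the a priori bound. *)
  apply: (sup_absorb (K := expR (A - 1)) g2) => [u /andP[su us']|S v /andP[sv vs'] hS].
    have uT : 0 <= u <= T by rewrite (le_trans s0 su) (le_trans us').
    rewrite rho0/=; have [ru|ru] := leP (rho y 0 u) 0.
      exact: le_trans (expR_ge0 _).
    rewrite -ler_ln ?posrE ?expR_gt0// expRK.
    by have := Lam_ge1 y1 c0 uT; rewrite /rho; lra.
  have -> : rho y 0 v = cmod (D s y + (D v y - D s y)) by rewrite addrC subrK.
  by apply: le_trans (cmodD _ _) _; rewrite lerD2l inc.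
apply: le_trans (inc _ _ ss' (lexx _) rho2) _.
by rewrite mulrAC.
Qed.

Let A_ge1 : 1 <= A.
Proof.
(* Since ln 0 = 0 by convention, the pair of equal points gives 1 <= A. *)
have := @Lam_ge1 0 0 0; rewrite /rho subrr cmod0 ln0// subr0 lexx.
by apply.
Qed.

(* Real induction on the time s: over a short time, uniformly on the annulus,
   D s' y / D s y stays in a half plane where the argument is an arctangent. *)
Lemma exists_rotation (r s : R) : let L := expR h * Lam r in
  0 < r -> r <= 1 -> 0 <= s <= T ->
  exists a : R * R -> R,
    (forall p, annulus r p ->
       a q @[q --> within (annulus r) (nbhs p)] --> a p) /\
    forall p, annulus r p ->
      D s (pt p) = (cmod (D s (pt p)) / cmod (pt p))%:C * pt p * cis (a p) /\
      `|a p| <= 4 * (time_weight L s - time_weight L 0).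
Proof.
move=> L r0 r1; move: s.
have L0 : 0 <= L.
  by rewrite mulr_ge0 ?expR_ge0// subr_ge0 (le_trans _ A_ge1)// (le_trans (ln_le0 r1)).
apply: real_induction => //.
  exists (fun=> 0); split=> [p _|p /andP[rp p1]]; first exact: cvg_cst.
  rewrite /D !X0 subr0 divff ?cis0 ?mulr1 ?mul1r ?normr0 ?subrr ?mulr0//.
  by rewrite gt_eqF// (lt_le_trans r0).
move=> s0 s0T.
(* With growth below 1/4, D_s' differs from D_s by at most |D_s| / 2, uniformly on the annulus. *)
have [|d d0 hd] := time_weight_uc L0 (e := 1 / 4); first by rewrite divr_gt0.
exists (d / 2); first by rewrite divr_gt0.
move=> s s' s0' ss' s'T sd s'd [a [ca ha]].
have g2 : time_weight L s' - time_weight L s < 1 / 4.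
  apply: hd => //; move: sd s'd; rewrite !ltr_norml => /andP[? ?] /andP[? ?]; lra.
have sT : 0 <= s <= T by rewrite s0' (le_trans ss').
have s'T' : 0 <= s' <= T by rewrite s'T (le_trans s0').
have g0 : 0 <= time_weight L s' - time_weight L s.
  by rewrite subr_ge0 time_weight_nd.
(* Same argument as the quotient D_s' / D_s, but without division, so real and imaginary parts are
   polynomial. *)
pose w p := D s' (pt p) * (D s (pt p))^*%C.
have Dp0 p : annulus r p -> 0 < cmod (D s (pt p)).
  move=> /andP[rp p1]; have y0 : pt p != 0 by rewrite -cmod_gt0 (lt_le_trans r0).
  by have [] := flow_osgood p1 _ y0 sT; rewrite ?cmod0.
have hw p : annulus r p ->
    cmod (w p - (cmod (D s (pt p)) ^+ 2)%:C) <=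
    2 * (time_weight L s' - time_weight L s) * cmod (D s (pt p)) ^+ 2.
  move=> rp; have g2' : time_weight L s' - time_weight L s <= 1 / 2 by lra.
  have := flow_increment r0 rp s0' ss' s'T g2'.
  rewrite /w -mulcJE -mulrBl cmodM cmodJ => hD.
  by rewrite expr2 mulrA ler_wpM2r// cmod_ge0.
have Rew p : annulus r p -> cmod (D s (pt p)) ^+ 2 / 2 <= complex.Re (w p).
  move=> rp; have /(le_trans (normr_Re _)) := hw _ rp.
  rewrite raddfB/= ler_norml => /andP[+ _].
  have : (time_weight L s' - time_weight L s) * cmod (D s (pt p)) ^+ 2 <=
      1 / 4 * cmod (D s (pt p)) ^+ 2 by rewrite ler_wpM2r ?sqr_ge0// ltW.
  lra.
have Rew0 p : annulus r p -> 0 < complex.Re (w p).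
  by move=> rp; apply: lt_le_trans (Rew _ rp); rewrite divr_gt0// exprn_gt0// Dp0.
(* The angle gained from s to s'. If g is the growth of the weight, |Im w| <= 2 g |D_s|^2 and Re w
   >= |D_s|^2 / 2, so it is at most 4 g. *)
pose b p := atan (complex.Im (w p) / complex.Re (w p)).
exists (fun p => a p + b p); split.
  move=> p rp; apply: cvgD; first exact: ca.
  apply: (@continuous_cvg _ _ _ _ _
    (fun q => complex.Im (w q) / complex.Re (w q)) (@atan R)).
    exact: continuous_atan.
  have wE q : complex.Re (w q) =
      complex.Re (D s' (pt q)) * complex.Re (D s (pt q)) +
      complex.Im (D s' (pt q)) * complex.Im (D s (pt q)).
    by rewrite /w; case: (D s' _) (D s _) => [? ?] [? ?] /=; ring.
  have wI q : complex.Im (w q) =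
      complex.Im (D s' (pt q)) * complex.Re (D s (pt q)) -
      complex.Re (D s' (pt q)) * complex.Im (D s (pt q)).
    by rewrite /w; case: (D s' _) (D s _) => [? ?] [? ?] /=; ring.
  have hRe z z' : `|complex.Re z - complex.Re z'| <= cmod (z - z' : R[i]).
    by rewrite -raddfB normr_Re.
  have hIm z z' : `|complex.Im z - complex.Im z'| <= cmod (z - z' : R[i]).
    by rewrite -raddfB normr_Im.
  apply: cvgM; last apply: cvgV.
  - under eq_fun do rewrite wI.
    by rewrite wI; apply: cvgB; apply: cvgM; apply: flow_cvg.
  - by rewrite gt_eqF// Rew0.
  - under eq_fun do rewrite wE.
    by rewrite wE; apply: cvgD; apply: cvgM; apply: flow_cvg.
move=> p rp; have [Dsp ap] := ha p rp; split; last first.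
  apply: le_trans (ler_normD _ _) _.
  have -> : 4 * (time_weight L s' - time_weight L 0) =
      4 * (time_weight L s - time_weight L 0) +
      4 * (time_weight L s' - time_weight L s) by ring.
  apply: lerD ap _; apply: le_trans (normr_atan_le _) _.
  rewrite normrM normfV (gtr0_norm (Rew0 _ rp)) ler_pdivrMr ?Rew0//.
  have : `|complex.Im (w p)| <=
      2 * (time_weight L s' - time_weight L s) * cmod (D s (pt p)) ^+ 2.
    apply: le_trans (hw _ rp); apply: le_trans (normr_Im _).
    by rewrite raddfB/= subr0.
  move/le_trans; apply.
  have : (time_weight L s' - time_weight L s) * (cmod (D s (pt p)) ^+ 2 / 2) <=
    (time_weight L s' - time_weight L s) * complex.Re (w p).
    by rewrite ler_wpM2l// Rew.
  lra.
have v0 : (cmod (D s (pt p)))%:C != 0 :> R[i].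
  by rewrite -cmod_gt0 cmodC gtr0_norm ?Dp0.
have y0 : (cmod (pt p))%:C != 0 :> R[i].
  rewrite -cmod_gt0 cmodC gtr0_norm; move: rp => /andP[/(lt_le_trans r0)//].
apply: (mulIf (expf_neq0 2 v0)); rewrite -rmorphXn/= -mulcJE.
rewrite [in LHS](mulrC (D s (pt p))) mulrA -/(w p).
rewrite {1}Dsp (cis_atan_right_half_plane (Rew0 _ rp)) -/(b p).
rewrite cmodM cmodJ cisD mulcJE !rmorphM/= fmorphV.
by field; rewrite y0.
Qed.

(** Continuity of [a] is relative to the annulus only, so the path has to converge within it. *)
Lemma rotation_along_path (r : R) (a : R * R -> R) (I : set R) (g1 g2 : R -> R) :
  (forall p, annulus r p -> a q @[q --> within (annulus r) (nbhs p)] --> a p) ->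
  continuous g1 -> continuous g2 -> (forall s, I s -> annulus r (g1 s, g2 s)) ->
  {within I, continuous (fun s => a (g1 s, g2 s))}.
Proof.
move=> ca c1 c2 Ig; apply/subspace_continuousP => s Is.
suff hw : (g1 u, g2 u) @[u --> within I (nbhs s)] -->
    within (annulus r) (nbhs (g1 s, g2 s)).
  exact: cvg_comp hw (ca _ (Ig _ Is)).
have hg : (g1 u, g2 u) @[u --> s] --> (g1 s, g2 s).
  exact: (@cvg_pair _ _ _ (nbhs s) (nbhs (g1 s)) (nbhs (g2 s)) _ _ _ g1 g2 (c1 s) (c2 s)).
move=> V hV; change (\forall u \near s, I u -> V (g1 u, g2 u)).
have {}hV : \forall u \near s, annulus r (g1 u, g2 u) -> V (g1 u, g2 u).
  exact: hg hV.
near=> u => Iu.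
have : annulus r (g1 u, g2 u) -> V (g1 u, g2 u) by near: u.
by apply; exact: Ig.
Unshelve. all: by end_near. Qed.

Lemma flow_rotation (t : R) (z : R[i]) : 0 <= t <= T -> 0 < cmod z < 1 ->
  let L := expR h * Lam (cmod z) in
  exists2 a : R,
    continued_arg (fun y => (X t y - X t 0) / (X t 1 - X t 0)) z a &
    `|a| <= 2 * pi + 8 * (time_weight L t - time_weight L 0).
Proof.
move=> tT /andP[r0 r1] L; pose f y := (X t y - X t 0) / (X t 1 - X t 0).
have [|theta theta2pi zE] := @polar_form R z; first by rewrite -cmod_gt0.
set r := cmod z in r0 r1 zE L *.
have [a [ca ha]] := exists_rotation r0 (ltW r1) tT.
pose p1 : R * R := (1, 0).
have ann1 : annulus r p1.
  by rewrite /annulus/= expr1n expr0n/= addr0 sqrtr1 lexx ltW.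
have ptp1 : pt p1 = 1 by [].
have fE p : annulus r p -> f (pt p) != 0 /\
    f (pt p) = (cmod (f (pt p)))%:C * (pt p / (cmod (pt p))%:C) *
      cis (a p - a p1).
  move=> rp; have Dn0 q : annulus r q -> D t (pt q) != 0.
    move=> /andP[rq q1]; rewrite -cmod_gt0.
    have y0 : pt q != 0 by rewrite -cmod_gt0 (lt_le_trans r0).
    by have [] := flow_osgood q1 _ y0 tT; rewrite ?cmod0.
  have D0 := Dn0 _ rp; have D10 := Dn0 _ ann1.
  have fD : f (pt p) = D t (pt p) / D t (pt p1) by [].
  split; first by rewrite fD mulf_neq0 ?invr_neq0.
  have [Dp _] := ha _ rp; have [D1 _] := ha _ ann1.
  have cp : (cmod (D t (pt p)))%:C != 0 :> R[i].
    by rewrite -cmod_gt0 cmodC ger0_norm ?cmod_ge0// cmod_gt0.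
  have c1 : (cmod (D t (pt p1)))%:C != 0 :> R[i].
    by rewrite -cmod_gt0 cmodC ger0_norm ?cmod_ge0// cmod_gt0.
  have cy : (cmod (pt p))%:C != 0 :> R[i].
    rewrite -cmod_gt0 cmodC ger0_norm ?cmod_ge0//; move: rp => /andP[/(lt_le_trans r0)//].
  rewrite fD cmodM cmodV {1}Dp {1}D1 cisD cisN.
  rewrite ptp1 cmod1 divr1 mulr1 !rmorphM !fmorphV/=.
  by field; rewrite cis_neq0 c1 cy.
have th0 : 0 <= theta by case/andP: theta2pi.
(* The argument of y is s on the arc and the constant theta on the radius; dividing by D_t(1)
   subtracts [a p1], which makes the lift start at 0. *)
pose u1 (s : R) := s + a (cos s, sin s) - a p1.
pose u2 (s : R) := theta + a (s * cos theta, s * sin theta) - a p1.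
have annc s : annulus r (cos s, sin s).
  by rewrite /annulus/= cos2Dsin2 sqrtr1 lexx ltW.
have rayE s : s%:C * cis theta = pt (s * cos theta, s * sin theta).
  by apply/eqP; rewrite eq_complex/= !mul0r subr0 addr0 !eqxx.
have annr s : r <= s <= 1 -> annulus r (s * cos theta, s * sin theta).
  move=> /andP[rs s1]; rewrite /annulus /mkset -rayE cmodM cmod_cis mulr1 cmodC.
  by rewrite ger0_norm ?rs// (le_trans (ltW r0)).
exists (u2 r); last first.
  have /andP[th1 th2] := theta2pi.
  have [|_ b1] := ha _ (annr r _); first by rewrite lexx ltW.
  have [_ b2] := ha _ ann1.
  rewrite /u2; apply: le_trans (ler_normB _ _) _.
  (* theta <= 2 pi, and the rotations at z and at 1 contribute 4 each, whence 8. *)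
  have := ler_normD theta (a (r * cos theta, r * sin theta)).
  rewrite (ger0_norm th1) /L; lra.
exists r, theta, u1, u2; split=> //.
- by rewrite r0 r1.
- split; last by rewrite /u1 cos0 sin0 add0r subrr.
  split.
    have cr := @rotation_along_path r a `[0, theta] cos sin ca
      (@continuous_cos R) (@continuous_sin R) (fun s _ => annc s).
    move=> s; apply: cvgB; last exact: cvg_cst.
    by apply: cvgD; [apply: continuous_subspaceT => x; exact: cvg_id|exact: cr].
  move=> s _; have [f0 fs] := fE _ (annc s); split => //.
  rewrite [LHS]fs /u1 -addrA (cisD _ (_ - _)) [RHS]mulrA; congr (_ * _ * _).
  by rewrite -/(cis s) cmod_cis divr1.
- split; last by rewrite /u2 /u1 !mul1r.
  split.
    have cr := @rotation_along_path r a `[r, 1]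
      (fun s => s * cos theta) (fun s => s * sin theta) ca.
    move=> s; apply: cvgB; last exact: cvg_cst.
    apply: cvgD; first exact: cvg_cst.
    apply: cr => //.
    + by move=> x; apply: cvgMl; exact: cvg_id.
    + by move=> x; apply: cvgMl; exact: cvg_id.
  move=> s; rewrite /= in_itv/= => rs; have [f0 fs] := fE _ (annr _ rs).
  rewrite rayE; split => //.
  rewrite [LHS]fs /u2 -addrA (cisD _ (_ - _)) [RHS]mulrA; congr (_ * _ * _).
  have s0 : 0 < s by case/andP: rs => /(lt_le_trans r0).
  rewrite -rayE cmodM cmod_cis mulr1 cmodC gtr0_norm// mulrAC divff ?mul1r//.
  by rewrite -cmod_gt0 cmodC gtr0_norm.
Qed.

End FlowRotation.

(** * The Biot-Savart kernel *)

Section ComplexMeasurability.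
Context {R : realType} d (U : measurableType d).
Implicit Types (f g : U -> R[i]) (E : set U).

Lemma measurable_fun_inv_ge0 E (f : U -> R) : (forall x, 0 <= f x) ->
  measurable_fun E f -> measurable_fun E (fun x => (f x)^-1).
Proof.
(* Powers are measurable, and the power -1 agrees with the inverse at 0 too, where both are 0. *)
move=> f0 mf; rewrite [X in measurable_fun _ X](_ : _ = (fun x => f x `^ (-1))).
  exact: measurableT_comp (measurable_powR _) mf.
by apply/funext => x; rewrite powR_inv1.
Qed.

Lemma measurable_cmod E f : cmeasurable E f -> measurable_fun E (cmod \o f).
Proof.
move=> [mr mi].
rewrite [X in measurable_fun _ X](_ : _ = (fun x =>
    (complex.Re (f x) ^+ 2 + complex.Im (f x) ^+ 2) `^ 2^-1)).
  apply: measurableT_comp (measurable_powR _) _.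
  by apply: measurable_funD; exact: measurable_funX.
by apply/funext => x /=; rewrite powR12_sqrt ?addr_ge0 ?sqr_ge0// cmodE.
Qed.

Lemma cmeasurable_cst E (c : R[i]) : cmeasurable E (fun=> c).
Proof. by split; exact: measurable_cst. Qed.

Lemma cmeasurableB E f g : cmeasurable E f -> cmeasurable E g ->
  cmeasurable E (fun x => f x - g x).
Proof.
move=> [fr fi] [gr gi]; split.
  under eq_fun do rewrite raddfB/=; exact: measurable_funB.
under eq_fun do rewrite raddfB/=; exact: measurable_funB.
Qed.

Lemma cmeasurableM E f g : cmeasurable E f -> cmeasurable E g ->
  cmeasurable E (fun x => f x * g x).
Proof.
move=> [fr fi] [gr gi].
have RM (z w : R[i]) : complex.Re (z * w) =
    complex.Re z * complex.Re w - complex.Im z * complex.Im w.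
  by case: z w => [? ?] [? ?].
have IM (z w : R[i]) : complex.Im (z * w) =
    complex.Re z * complex.Im w + complex.Im z * complex.Re w.
  by case: z w => [? ?] [? ?].
split.
  by under eq_fun do rewrite RM; apply: measurable_funB; exact: measurable_funM.
by under eq_fun do rewrite IM; apply: measurable_funD; exact: measurable_funM.
Qed.

Lemma cmeasurableV E f : cmeasurable E f -> cmeasurable E (fun x => (f x)^-1).
Proof.
move=> mf; have mn : measurable_fun E (fun x => (cmod (f x) ^+ 2)^-1).
  apply: measurable_fun_inv_ge0 => [x|]; first exact: sqr_ge0.
  by apply: measurable_funX; exact: measurable_cmod.
have [mr mi] := mf; split.
  rewrite [X in measurable_fun _ X](_ : _ = (fun x =>
      complex.Re (f x) * (cmod (f x) ^+ 2)^-1)); first exact: measurable_funM.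
  by apply/funext => x; rewrite cmod_sqr; case: (f x).
rewrite [X in measurable_fun _ X](_ : _ = (fun x =>
    - (complex.Im (f x) * (cmod (f x) ^+ 2)^-1))).
  by apply: measurable_funN; exact: measurable_funM.
by apply/funext => x; rewrite cmod_sqr; case: (f x).
Qed.

Lemma cmeasurable_BS_kernel E f : cmeasurable E f ->
  cmeasurable E (fun x => BS_kernel (f x)).
Proof.
move=> [mr mi]; apply: cmeasurableM; first exact: cmeasurable_cst.
apply: cmeasurableV; apply: cmeasurableM; first exact: cmeasurable_cst.
split.
  rewrite [X in measurable_fun _ X](_ : _ = (fun x => complex.Re (f x)))//.
  by apply/funext => x; case: (f x).
rewrite [X in measurable_fun _ X](_ : _ = (fun x => - complex.Im (f x))).
  exact: measurable_funN.
by apply/funext => x; case: (f x).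
Qed.

End ComplexMeasurability.

Section BiotSavartKernel.
Context {R : realType}.
Implicit Types z w : R[i].

Lemma invr_2pi_le1 : (2 * pi)^-1 <= 1 :> R.
Proof.
by rewrite invf_le1 ?mulr_gt0 ?pi_gt0//; have := pi_ge2 R; lra.
Qed.

Lemma cmod_BS_kernel z : cmod (BS_kernel z) = (2 * pi)^-1 / cmod z.
Proof.
rewrite cmodM cmodV cmodM cmodC cmodJ ger0_norm ?mulr_ge0 ?pi_ge0//.
by rewrite cmodE/= expr0n add0r expr1n sqrtr1 mul1r invfM.
Qed.

Lemma cmod_BS_kernelB z w : z != 0 -> w != 0 ->
  cmod (BS_kernel z - BS_kernel w) =
  (2 * pi)^-1 * (cmod (z - w) / (cmod z * cmod w)).
Proof.
move=> z0 w0.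
have -> : BS_kernel z - BS_kernel w =
    'i%C / (2 * pi)%:C * (- (z - w)^*%C / (z^*%C * w^*%C)).
  have k0 : (2 * pi)%:C != 0 :> R[i].
    by rewrite -cmod_gt0 cmodC normr_gt0 mulf_neq0// gt_eqF// pi_gt0.
  rewrite /BS_kernel rmorphB/=; move: (2 * pi)%:C k0 => k k0; field.
  by rewrite k0 !conjc_eq0 z0 w0.
rewrite cmodM cmodM cmodV cmodC ger0_norm ?mulr_ge0 ?pi_ge0//.
rewrite cmodM cmodN cmodV cmodM !cmodJ; congr (_ * _).
by rewrite cmodE/= expr0n add0r expr1n sqrtr1 mul1r.
Qed.

End BiotSavartKernel.

(** * Integrals of radial kernels, estimated over dyadic shells *)

Section DyadicSquares.
Context {R : realType}.
Local Notation mR := (measurableTypeR R).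
Local Notation plane := (mR * mR)%type.

(** Squares stand in for discs: they contain them, and their measure is a product of two lengths. *)
Definition square (z : R[i]) (r : R) : set plane :=
  (`[complex.Re z - r, complex.Re z + r] `*`
   `[complex.Im z - r, complex.Im z + r])%classic.

Lemma measurable_square z r : measurable (square z r).
Proof. exact: measurableX. Qed.

Lemma leb2_square z (r : R) : 0 <= r -> leb2 (square z r) = (4 * r ^+ 2)%:E.
Proof.
move=> r0.
have h (x : R) : leb1 (`[x - r, x + r]%classic : set mR) = (2 * r)%:E.
  rewrite [LHS](lebesgue_measure_itv `[x - r, x + r])/= lte_fin.
  case: ltP => [_|h]; first by rewrite -EFinD; congr EFin; ring.
  by congr EFin; lra.
rewrite /leb2 /square product_measure1E// [X in (X * _)%E]h [X in (_ * X)%E]h.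
by rewrite -EFinM; congr EFin; ring.
Qed.

Lemma cmod_le_square z (r : R) (p : plane) :
  cmod (z - cplx p) <= r -> square z r p.
Proof.
move=> zr; have := le_trans (normr_Re _) zr; have := le_trans (normr_Im _) zr.
rewrite !raddfB/= !ler_norml => /andP[h1 h2] /andP[h3 h4].
by split; rewrite /= in_itv/=; apply/andP; split; lra.
Qed.

Lemma cmeasurable_cplx E : cmeasurable E (cplx : plane -> R[i]).
Proof.
by split; apply: measurable_funTS; [exact: measurable_fst|exact: measurable_snd].
Qed.

Lemma measurable_dist z : measurable_fun setT (fun p : plane => cmod (z - cplx p)).
Proof.
apply: (@measurable_cmod _ _ _ _ (fun p : plane => z - cplx p)).
by apply: cmeasurableB; [exact: cmeasurable_cst|exact: cmeasurable_cplx].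
Qed.

(** Take the least n with r / 2^n < x; it is not 0 because x <= r, and its predecessor is k. *)
Lemma dyadic_slot (r x : R) : 0 < x -> x <= r ->
  exists k : nat, r / 2 ^+ k.+1 < x <= r / 2 ^+ k.
Proof.
move=> x0 xr; have r0 := lt_le_trans x0 xr.
pose P n := r / 2 ^+ n < x.
have exP : exists n, P n.
  exists (Num.bound (r / x)); rewrite /P ltr_pdivrMr ?exprn_gt0// mulrC.
  rewrite -ltr_pdivrMr//; have := archi_boundP (divr_ge0 (ltW r0) (ltW x0)).
  by move/lt_trans; apply; rewrite -natrX ltr_nat ltn_expl.
case: (ex_minnP exP) => -[|n] Pn minn.
  by move: Pn; rewrite /P expr0 divr1 ltNge xr.
exists n; apply/andP; split; first exact: Pn.
by rewrite leNgt; apply/negP => h; have := minn n h; rewrite ltnn.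
Qed.

(** A point at distance in (0, r] lies in one shell, and the shell is enlarged to the square around
    its outer disc. The centre lies in no shell, whence [g 0 = 0]. *)
Lemma dyadic_integral_le z (r : R) (g : R -> R) (a : nat -> R) :
  (forall x, 0 <= g x) -> (forall k, 0 <= a k) -> 0 < r ->
  measurable_fun setT (fun p : plane => g (cmod (z - cplx p))) ->
  g 0 = 0 -> (forall x, r < x -> g x = 0) ->
  (forall k x, r / 2 ^+ k.+1 < x <= r / 2 ^+ k -> g x <= a k) ->
  (\int[leb2]_p (g (cmod (z - cplx p)))%:E <=
   \sum_(k <oo) (a k * (4 * (r / 2 ^+ k) ^+ 2))%:E)%E.
Proof.
move=> g0 a0 r0 mg g00 gr ga.
pose u k (p : plane) := ((a k)%:E * (\1_(square z (r / 2 ^+ k)) p)%:E)%E.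
have u0 k p : (0 <= u k p)%E by rewrite mule_ge0 ?lee_fin.
have mu k : measurable_fun setT (u k).
  apply: emeasurable_funM; first exact: measurable_cst.
  by apply/measurable_EFinP/measurable_indic; exact: measurable_square.
have s0 p : (0 <= \sum_(k <oo) u k p)%E by apply: nneseries_ge0 => *; exact: u0.
apply: (@le_trans _ _ (\int[leb2]_p (\sum_(k <oo) u k p))%E).
  apply: ge0_le_integral => //.
  - by move=> p _; rewrite lee_fin.
  - exact/measurable_EFinP.
  - by apply: ge0_emeasurable_sum => // k p _ _; exact: u0.
  move=> p _; set x := cmod _.
  have [x0|x0] := leP x 0.
    by rewrite (_ : x = 0) ?g00//; apply/eqP; rewrite eq_le x0 cmod_ge0.
  have [xr|rx] := leP x r; last by rewrite gr.
  have [k /andP[k1 k2]] := dyadic_slot x0 xr.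
  apply: (@le_trans _ _ (u k p)).
    rewrite /u indicE mem_set; last exact: cmod_le_square.
    by rewrite mule1 lee_fin ga// k1.
  apply: le_trans (@nneseries_lim_ge R (u ^~ p) xpredT 0%N k.+1 _).
    by rewrite big_nat_recr//= leeDr// sume_ge0.
  by move=> *; exact: u0.
rewrite integral_nneseries//.
apply: lee_nneseries => [k _ _|k _]; first exact: integral_ge0.
rewrite ge0_integralZl_EFin//; last first.
  by apply/measurable_EFinP/measurable_indic; exact: measurable_square.
rewrite integral_indic//; last exact: measurable_square.
rewrite setIT [X in (_ * X <= _)%E](leb2_square z (r := r / 2 ^+ k))//.
by rewrite divr_ge0 ?exprn_ge0// ltW.
Qed.

(** Up to 1 / (2 pi), the modulus of the Biot-Savart kernel cut off at radius r; it is 0 at the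
    pole, as 0^-1 = 0. *)
Definition near_kernel (r x : R) : R := if x <= r then x^-1 else 0.

(** Away from its poles, the difference of two Biot-Savart kernels is of this size per unit distance
    between them. *)
Definition annulus_kernel (s r x : R) : R := if s < x <= r then x^-2 else 0.

Lemma measurable_near_kernel z r :
  measurable_fun setT (fun p : plane => near_kernel r (cmod (z - cplx p))).
Proof.
apply: measurable_fun_ifT; last exact: measurable_cst.
  by apply: measurable_fun_ler; [exact: measurable_dist|exact: measurable_cst].
by apply: measurable_fun_inv_ge0 => [p|]; [exact: cmod_ge0|exact: measurable_dist].
Qed.

Lemma measurable_annulus_kernel z s r :
  measurable_fun setT (fun p : plane => annulus_kernel s r (cmod (z - cplx p))).
Proof.
apply: measurable_fun_ifT; last exact: measurable_cst.
  apply: measurable_and.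
    by apply: measurable_fun_ltr; [exact: measurable_cst|exact: measurable_dist].
  by apply: measurable_fun_ler; [exact: measurable_dist|exact: measurable_cst].
apply: measurable_fun_inv_ge0 => [p|]; first by rewrite exprn_ge0// cmod_ge0.
by apply: measurable_funX; exact: measurable_dist.
Qed.

Lemma near_kernel_ge0 (r x : R) : 0 <= x -> 0 <= near_kernel r x.
Proof. by move=> x0; rewrite /near_kernel; case: ifP => // _; rewrite invr_ge0. Qed.

Lemma annulus_kernel_ge0 (s r x : R) : 0 <= annulus_kernel s r x.
Proof.
rewrite /annulus_kernel; case: ifP => // _.
by rewrite invr_ge0 sqr_ge0.
Qed.

Lemma integral_near_kernel z (r : R) : 0 < r ->
  (\int[leb2]_p (near_kernel r (cmod (z - cplx p)))%:E <= (16 * r)%:E)%E.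
Proof.
move=> r0.
(* The absolute value makes the profile nonnegative on the whole line. *)
have := @dyadic_integral_le z r (fun x => near_kernel r `|x|)
  (fun k => 2 ^+ k.+1 / r).
under eq_integral do rewrite ger0_norm ?cmod_ge0//.
under eq_fun do rewrite ger0_norm ?cmod_ge0//.
move=> /(_ _ _ r0 (measurable_near_kernel z r)) h.
apply: le_trans (h _ _ _ _ _) _.
- by move=> x; rewrite near_kernel_ge0.
- by move=> k; rewrite divr_ge0 ?exprn_ge0// ltW.
- by rewrite /near_kernel normr0 ltW// invr0.
- by move=> x rx; rewrite /near_kernel ifN// -ltNge (lt_le_trans rx)// ler_norm.
- move=> k x /andP[x1 x2].
  have x0 : 0 < x by rewrite (lt_trans _ x1)// divr_gt0// exprn_gt0.
  rewrite gtr0_norm// /near_kernel; case: ifP => _.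
    by rewrite -[leRHS]invrK invf_div lef_pV2 ?posrE ?divr_gt0 ?exprn_gt0// ltW.
  by rewrite divr_ge0 ?exprn_ge0// ltW.
(* The k-th term is (2^(k+1) / r) (4 r^2 / 4^k) = 16 r / 2^(k+1), a geometric series with sum 16
   r. *)
apply: le_trans (epsilon_trick0 xpredT (_ : 0 <= 16 * r)); last first.
  by rewrite mulr_ge0// ltW.
apply: lee_nneseries => k _ => [_|].
  by rewrite lee_fin mulr_ge0// ?divr_ge0 ?exprn_ge0 ?mulr_ge0// ?sqr_ge0// ltW.
rewrite lee_fin natrX le_eqVlt; apply/orP; left; apply/eqP.
have k0 : 2 ^+ k != 0 :> R by rewrite expf_neq0.
by rewrite !exprS; field; rewrite k0 gt_eqF.
Qed.

(** Every shell contributes the same amount, (2^(k+1) / r)^2 (4 r^2 / 4^k) = 16. The number of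
    shells is the source of the logarithm in the modulus of continuity. *)
Lemma integral_annulus_kernel z (r : R) N : 0 < r ->
  (\int[leb2]_p (annulus_kernel (r / 2 ^+ N) r (cmod (z - cplx p)))%:E <=
   (16 * N%:R)%:E)%E.
Proof.
move=> r0.
pose a k : R := if (k < N)%N then (2 ^+ k.+1 / r) ^+ 2 else 0.
have a0 k : 0 <= a k by rewrite /a; case: ifP => // _; rewrite sqr_ge0.
apply: le_trans (dyadic_integral_le _ a0 r0 (measurable_annulus_kernel _ _ _) _ _ _) _.
- by move=> x; exact: annulus_kernel_ge0.
- by rewrite /annulus_kernel ifN// negb_and -leNgt divr_ge0 ?exprn_ge0// ltW.
- by move=> x rx; rewrite /annulus_kernel ifN// negb_and -!ltNge rx orbT.
- move=> k x /andP[x1 x2]; rewrite /annulus_kernel /a.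
  have x0 : 0 < x by rewrite (lt_trans _ x1)// divr_gt0// exprn_gt0.
  case: ifP => [/andP[Nx _]|_]; last by case: ifP => // _; rewrite sqr_ge0.
  rewrite ifT.
    rewrite -exprVn ler_pXn2r ?nnegrE ?invr_ge0 ?divr_ge0 ?exprn_ge0 ?(ltW x0)//;
      last exact: ltW.
    rewrite -[leRHS]invrK invf_div lef_pV2 ?posrE ?divr_gt0 ?exprn_gt0//.
    exact: ltW.
  rewrite ltnNge; apply/negP => Nk; move: Nx; rewrite ltNge => /negP; apply.
  rewrite (le_trans x2)// ler_wpM2l ?(ltW r0)// lef_pV2 ?posrE ?exprn_gt0//.
  by rewrite ler_weXn2l// ler1n.
have t0 k : 0 <= a k * (4 * (r / 2 ^+ k) ^+ 2).
  by rewrite mulr_ge0// mulr_ge0// sqr_ge0.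
apply: lime_le; first by apply: is_cvg_nneseries => k _ _; rewrite lee_fin.
apply: nearW => n; rewrite sumEFin lee_fin.
rewrite (eq_bigr (fun k => if (k < N)%N then 16 else 0)); last first.
  move=> k _; rewrite /a; case: ifP => _; last by rewrite mul0r.
  have k0 : 2 ^+ k != 0 :> R by rewrite expf_neq0.
  by rewrite !exprS; field; rewrite k0 gt_eqF.
apply: (@le_trans _ _ (16 * (minn n N)%:R)); last first.
  by rewrite ler_wpM2l// ler_nat geq_minr.
elim: n => [|n ih]; first by rewrite big_nil min0n mulr0.
rewrite big_nat_recr//=; apply: le_trans (lerD ih (lexx _)) _.
have [nN|nN] := ltnP n N.
  by rewrite (minn_idPl nN) -[n.+1%:R]natr1 mulrDr mulr1.
by rewrite addr0 (minn_idPr _)// ltnW.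
Qed.

End DyadicSquares.

(** * The velocity field at a fixed time *)

Section ComplexIntegral.
Context {R : realType} d (U : measurableType d) (mu : {measure set U -> \bar R}).
Implicit Types (f g : U -> R[i]) (E : set U).

Lemma cintegrable_lty E f : measurable E -> cmeasurable E f ->
  (\int[mu]_(x in E) (cmod (f x))%:E < +oo)%E -> cintegrable mu E f.
Proof.
move=> mE mf foo; have [mr mi] := mf.
have mc := measurable_cmod mf.
have ic : mu.-integrable E (fun x => (cmod (f x))%:E).
  apply/integrableP; split; first exact/measurable_EFinP.
  by under eq_integral do rewrite gee0_abs ?lee_fin ?cmod_ge0//.
split; apply: le_integrable ic => //.
- exact/measurable_EFinP.
- by move=> x _; rewrite /= lee_fin (ger0_norm (cmod_ge0 _)) normr_Re.
- exact/measurable_EFinP.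
- by move=> x _; rewrite /= lee_fin (ger0_norm (cmod_ge0 _)) normr_Im.
Qed.

Lemma cintegrable_cmeasurable E f : cintegrable mu E f -> cmeasurable E f.
Proof.
by move=> [/measurable_int/measurable_EFinP mr /measurable_int/measurable_EFinP mi].
Qed.

Lemma integrable_cmod E f : measurable E -> cintegrable mu E f ->
  mu.-integrable E (fun x => (cmod (f x))%:E).
Proof.
move=> mE if_; have [ir ii] := if_.
apply: (le_integrable mE _ _ (integrableD mE (integrable_abse ir) (integrable_abse ii))).
  exact/measurable_EFinP/measurable_cmod/cintegrable_cmeasurable.
move=> x _ /=; rewrite lee_fin (ger0_norm (cmod_ge0 _)).
by rewrite ger0_norm ?addr_ge0// cmod_le.
Qed.

(** The factor 2 comes from estimating the real and imaginary parts separately. *)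
Lemma cmod_cintegral_le E f (c : R) : measurable E -> cintegrable mu E f ->
  (\int[mu]_(x in E) (cmod (f x))%:E <= c%:E)%E ->
  cmod (cintegral mu E f) <= 2 * c.
Proof.
move=> mE if_ fc; have [ir ii] := if_.
have ic := integrable_cmod mE if_.
have fin : fine (\int[mu]_(x in E) (cmod (f x))%:E) <= c.
  by rewrite -lee_fin fineK// integrable_fin_num.
apply: le_trans (cmod_le _) _; rewrite mulr_natl mulr2n /cintegral/=.
apply: lerD; apply: le_trans fin.
- apply: le_trans (le_normr_Rintegral mE ir) _.
  apply: le_Rintegral => // [|x _]; last exact: normr_Re.
  by have := integrable_abse ir; apply: eq_integrable.
- apply: le_trans (le_normr_Rintegral mE ii) _.
  apply: le_Rintegral => // [|x _]; last exact: normr_Im.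
  by have := integrable_abse ii; apply: eq_integrable.
Qed.

Lemma cintegrableB E f g : measurable E -> cintegrable mu E f ->
  cintegrable mu E g -> cintegrable mu E (fun x => f x - g x).
Proof.
move=> mE [fr fi] [gr gi]; split.
  by apply: eq_integrable (integrableB mE fr gr) => // x _; rewrite raddfB.
by apply: eq_integrable (integrableB mE fi gi) => // x _; rewrite raddfB.
Qed.

Lemma cintegralB E f g : measurable E -> cintegrable mu E f ->
  cintegrable mu E g ->
  cintegral mu E (fun x => f x - g x) = cintegral mu E f - cintegral mu E g.
Proof.
move=> mE [fr fi] [gr gi]; rewrite /cintegral; apply/eqP; rewrite eq_complex/=.
apply/andP; split; apply/eqP; rewrite -RintegralB//; apply: eq_Rintegral => x _;
  exact: raddfB.
Qed.

End ComplexIntegral.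

Section NonnegativeIntegralBounds.
Context {R : realType} d (U : measurableType d) (mu : {measure set U -> \bar R}).
Implicit Types f g : U -> R.

Lemma integralZ_le f (a A : R) : 0 <= a -> (forall x, 0 <= f x) ->
  measurable_fun setT f -> (\int[mu]_x (f x)%:E <= A%:E)%E ->
  (\int[mu]_x (a * f x)%:E <= (a * A)%:E)%E.
Proof.
move=> a0 f0 mf fA; under eq_integral do rewrite EFinM.
rewrite ge0_integralZl_EFin//.
- by rewrite [leRHS]EFinM; apply: lee_wpmul2l; rewrite ?lee_fin.
- by move=> x _; rewrite lee_fin.
- exact/measurable_EFinP.
Qed.

Lemma integralD_le f g (A B : R) : (forall x, 0 <= f x) -> (forall x, 0 <= g x) ->
  measurable_fun setT f -> measurable_fun setT g ->
  (\int[mu]_x (f x)%:E <= A%:E)%E -> (\int[mu]_x (g x)%:E <= B%:E)%E ->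
  (\int[mu]_x (f x + g x)%:E <= (A + B)%:E)%E.
Proof.
move=> f0 g0 mf mg fA gB; under eq_integral do rewrite EFinD.
rewrite ge0_integralD//.
- by rewrite [leRHS]EFinD; exact: leeD.
- by move=> x _; rewrite lee_fin.
- exact/measurable_EFinP.
- by move=> x _; rewrite lee_fin.
- exact/measurable_EFinP.
Qed.

End NonnegativeIntegralBounds.

(** * Growth and log-Lipschitz bounds for the velocity *)

Section VelocityEstimates.
Context {R : realType}.
Local Notation mR := (measurableTypeR R).
Local Notation plane := (mR * mR)%type.
Variables (w : R[i] -> R[i]) (M B : R).
Hypothesis M0 : 0 <= M.
Hypothesis mw : cmeasurable setT (fun p : plane => w (cplx p)).
Hypothesis wM : {ae leb2, forall p : plane, cmod (w (cplx p)) <= M}.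
(** Convergence at the origin controls all other points: far from z, the kernel at z is comparable
    to the kernel at 0. *)
Hypothesis wB :
  (\int[leb2]_p (cmod (BS_kernel (0 - cplx p) * w (cplx p)))%:E <= B%:E)%E.

Let vel z := cintegral leb2 setT (fun p : plane => BS_kernel (z - cplx p) * w (cplx p)).

Lemma cmeasurable_BS_mul z :
  cmeasurable setT (fun p : plane => BS_kernel (z - cplx p) * w (cplx p)).
Proof.
apply: cmeasurableM mw; apply: cmeasurable_BS_kernel.
by apply: cmeasurableB; [exact: cmeasurable_cst|exact: cmeasurable_cplx].
Qed.

Let far (p : plane) := cmod (BS_kernel (0 - cplx p) * w (cplx p)).

Let far_ge0 p : 0 <= far p.
Proof. exact: cmod_ge0. Qed.

Let measurable_far : measurable_fun setT far.
Proof. exact/measurable_cmod/cmeasurable_BS_mul. Qed.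

Lemma ae_cplx_neq0 : {ae leb2, forall p : plane, cplx p != 0}.
Proof.
exists (square 0 0); split.
- exact: measurable_square.
- by rewrite [LHS](leb2_square 0 (r := 0))// expr0n/= mulr0.
- move=> p /= /negP; rewrite negbK => /eqP p0; apply: cmod_le_square.
  by rewrite p0 subrr cmod0.
Qed.

(* As 0^-1 = 0, the term [far p] vanishes at cplx p = 0: that point is excluded. *)
Lemma integral_BS_le z :
  (\int[leb2]_p (cmod (BS_kernel (z - cplx p) * w (cplx p)))%:E <=
   (16 * M + (1 + cmod z) * B)%:E)%E.
Proof.
(* When |z - p| > 1, |p| <= |z| + |z - p| <= (1 + |z|) |z - p|, which compares the kernel at z with
   that at 0. *)
pose g p := M * near_kernel 1 (cmod (z - cplx p)) + (1 + cmod z) * far p.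
have mg1 := measurable_near_kernel z (1 : R).
have n0 p : 0 <= near_kernel 1 (cmod (z - cplx p)) by rewrite near_kernel_ge0 ?cmod_ge0.
have z1 : 0 <= 1 + cmod z by rewrite addr_ge0// cmod_ge0.
have mg : measurable_fun setT g.
  by apply: measurable_funD; apply: measurable_funM => //; exact: measurable_cst.
apply: (@le_trans _ _ (\int[leb2]_p (g p)%:E)%E).
  apply: ae_ge0_le_integral => //.
  - by move=> p _; rewrite lee_fin cmod_ge0.
  - exact/measurable_EFinP/measurable_cmod/cmeasurable_BS_mul.
  - by move=> p _; rewrite lee_fin addr_ge0// mulr_ge0// near_kernel_ge0// cmod_ge0.
  - exact/measurable_EFinP.
  apply: filterS2 wM ae_cplx_neq0 => p pM p0 _.
  rewrite lee_fin /g /far !(cmodM (BS_kernel _)).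
  rewrite !cmod_BS_kernel sub0r cmodN.
  have k0 : 0 <= (2 * pi)^-1 :> R by rewrite invr_ge0 mulr_ge0// pi_ge0.
  have := cmod_ge0 (z - cplx p); have := cmod_ge0 (w (cplx p)).
  move: (cmod (w (cplx p))) pM => W pM W0.
  have cp : 0 < cmod (cplx p) by rewrite cmod_gt0.
  have : cmod (cplx p) <= cmod z + cmod (z - cplx p).
    by rewrite -[X in cmod X <= _](subKr z) cmodB.
  move: (cmod (z - cplx p)) (cmod (cplx p)) cp => c q q0 qc c0.
  rewrite /near_kernel; case: ifP => c1.
    apply: (@le_trans _ _ (M * c^-1)); last by rewrite lerDl !mulr_ge0// invr_ge0 ltW.
    rewrite mulrC ler_pM ?(divr_ge0 k0 c0)//.
    by rewrite ler_piMl ?invr_ge0// invr_2pi_le1.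
  rewrite mulr0 add0r; move/negbT: c1; rewrite -ltNge => c1.
  rewrite mulrA ler_wpM2r// mulrCA ler_wpM2l//.
  rewrite ler_pdivlMr// ler_pdivrMl ?(lt_trans _ c1)//.
  apply: le_trans qc _; have := cmod_ge0 z; nra.
have c1 := integral_near_kernel z (@ltr01 R); rewrite mulr1 in c1.
rewrite (mulrC 16); apply: integralD_le.
- by move=> p; rewrite mulr_ge0.
- by move=> p; rewrite mulr_ge0.
- by apply: measurable_funM => //; exact: measurable_cst.
- by apply: measurable_funM => //; exact: measurable_cst.
- exact: integralZ_le.
- exact: integralZ_le.
Qed.

Lemma cintegrable_BS z :
  cintegrable leb2 setT (fun p : plane => BS_kernel (z - cplx p) * w (cplx p)).
Proof.
apply: cintegrable_lty => //; first exact: cmeasurable_BS_mul.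
exact: le_lt_trans (integral_BS_le z) (ltry _).
Qed.

Lemma cmod_velocity_le z : cmod (vel z) <= 2 * (16 * M + (1 + cmod z) * B).
Proof.
by apply: cmod_cintegral_le (integral_BS_le z) => //; exact: cintegrable_BS.
Qed.

Lemma ln2_ge : 1 / 2 <= ln 2 :> R.
Proof.
have h : ln 2^-1 <= 2^-1 - 1 :> R by rewrite ln_leB1// invr_gt0.
by move: h; rewrite lnV ?posrE//; lra.
Qed.

(* For |z - p| <= 2 |z - z'| the two kernels are integrated separately; beyond, their
   difference is of order |z - z'| / |z - p|^2, which is integrated over dyadic annuli
   up to radius 4 R0 and compared with the kernel at the origin further away. *)
Lemma integral_BSB_le z z' (R0 : R) : 1 <= R0 -> z != z' ->
  cmod z <= R0 -> cmod z' <= R0 ->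
  (\int[leb2]_p (cmod (BS_kernel (z - cplx p) * w (cplx p) -
                      BS_kernel (z' - cplx p) * w (cplx p)))%:E <=
   (cmod (z - z') * (64 * M * ((2 + ln (4 * R0)) - ln (cmod (z - z'))) +
      4 * B))%:E)%E.
Proof.
move=> R01 zz' zR0 z'R0; set dl := cmod (z - z').
have dl0 : 0 < dl by rewrite cmod_gt0 subr_eq0.
have dlR : dl <= 2 * R0 by rewrite (le_trans (cmodB _ _))//; lra.
set r := 4 * R0.
have r0 : 0 < r by rewrite /r; lra.
have dl20 : 0 < 2 * dl by rewrite mulr_gt0.
(* [k.+1] shells cover the distances from 2 |z - z'| to 4 R0; the slot exists because |z - z'| <= 2
   R0. *)
have [|k /andP[k1 k2]] := @dyadic_slot R r (2 * dl) dl20; first by rewrite /r; lra.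
pose g1 (p : plane) := near_kernel (2 * dl) (cmod (z - cplx p)).
(* The disc of radius 2 |z - z'| about z lies in the disc of radius 3 |z - z'| about z'. *)
pose g2 (p : plane) := near_kernel (3 * dl) (cmod (z' - cplx p)).
pose g3 (p : plane) := annulus_kernel (r / 2 ^+ k.+1) r (cmod (z - cplx p)).
have g10 p : 0 <= g1 p by rewrite near_kernel_ge0 ?cmod_ge0.
have g20 p : 0 <= g2 p by rewrite near_kernel_ge0 ?cmod_ge0.
have g30 p : 0 <= g3 p by rewrite annulus_kernel_ge0.
have mg1 : measurable_fun setT g1 by exact: measurable_near_kernel.
have mg2 : measurable_fun setT g2 by exact: measurable_near_kernel.
have mg3 : measurable_fun setT g3 by exact: measurable_annulus_kernel.
pose g p := M * g1 p + M * g2 p + (2 * dl * M) * g3 p + 4 * dl * far p.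
have c30 : 0 <= 2 * dl * M by rewrite mulr_ge0// ltW.
have c40 : 0 <= 4 * dl by rewrite mulr_ge0// ltW.
have mM1 : measurable_fun setT (fun p => M * g1 p).
  by apply: measurable_funM => //; exact: measurable_cst.
have mM2 : measurable_fun setT (fun p => M * g2 p).
  by apply: measurable_funM => //; exact: measurable_cst.
have mM3 : measurable_fun setT (fun p => (2 * dl * M) * g3 p).
  by apply: measurable_funM => //; exact: measurable_cst.
have mM4 : measurable_fun setT (fun p => (4 * dl) * far p).
  by apply: measurable_funM => //; exact: measurable_cst.
have p10 p : 0 <= M * g1 p by rewrite mulr_ge0.
have p20 p : 0 <= M * g2 p by rewrite mulr_ge0.
have p30 p : 0 <= 2 * dl * M * g3 p by rewrite mulr_ge0.
have p40 p : 0 <= 4 * dl * far p by rewrite mulr_ge0.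
apply: (@le_trans _ _ (\int[leb2]_p (g p)%:E)%E).
  apply: ae_ge0_le_integral => //.
  - by move=> p _; rewrite lee_fin cmod_ge0.
  - apply/measurable_EFinP; apply: (@measurable_cmod _ _ _ _ (fun p : plane => _ - _)).
    by apply: cmeasurableB; exact: cmeasurable_BS_mul.
  - by move=> p _; rewrite lee_fin /g !addr_ge0.
  - by apply/measurable_EFinP; do 3 apply: measurable_funD => //.
  apply: filterS2 wM ae_cplx_neq0 => p pM p0 _; rewrite lee_fin.
  rewrite -mulrBl cmodM.
  have k0 : 0 <= (2 * pi)^-1 :> R by rewrite invr_ge0 mulr_ge0// pi_ge0.
  have W0 := cmod_ge0 (w (cplx p)).
  have cc' : cmod (z' - cplx p) <= cmod (z - cplx p) + dl.
    have -> : z' - cplx p = z - cplx p - (z - z') by ring.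
    exact: cmodB.
  have c'c : cmod (z - cplx p) <= cmod (z' - cplx p) + dl.
    have -> : z - cplx p = z' - cplx p + (z - z') by ring.
    exact: cmodD.
  have [cd|cd] := leP (cmod (z - cplx p)) (2 * dl).
    apply: (@le_trans _ _ (M * g1 p + M * g2 p)); last first.
      by rewrite /g -addrA lerDl addr_ge0.
    rewrite -mulrDr mulrC ler_pM ?cmod_ge0//.
    apply: le_trans (cmodB _ _) _; rewrite !cmod_BS_kernel.
    rewrite /g1 /g2 /near_kernel cd ifT; last by apply: le_trans cc' _; lra.
    by apply: lerD; rewrite ler_piMl ?invr_ge0 ?cmod_ge0// invr_2pi_le1.
  have c0 : 0 < cmod (z - cplx p) by exact: lt_trans cd.
  have c'2 : cmod (z - cplx p) / 2 <= cmod (z' - cplx p) by lra.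
  have c'0 : 0 < cmod (z' - cplx p) by apply: lt_le_trans c'2; rewrite divr_gt0.
  rewrite cmod_BS_kernelB -?cmod_gt0//.
  rewrite (_ : z - cplx p - (z' - cplx p) = z - z') -/dl; last by ring.
  have kd : dl / (cmod (z - cplx p) * cmod (z' - cplx p)) <=
      2 * dl * (cmod (z - cplx p)) ^- 2.
    rewrite (mulrC 2) -mulrA; apply: ler_wpM2l; first exact: ltW.
    rewrite -invf_div lef_pV2 ?posrE ?mulr_gt0 ?divr_gt0 ?exprn_gt0//.
    by rewrite expr2 -mulrA ler_wpM2l// ltW.
  have [cr|cr] := leP (cmod (z - cplx p)) r.
    apply: (@le_trans _ _ (2 * dl * M * g3 p)); last first.
      by rewrite /g addrAC lerDr !addr_ge0.
    have -> : g3 p = (cmod (z - cplx p)) ^- 2.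
      by rewrite /g3 /annulus_kernel (lt_trans k1 cd) cr.
    rewrite [leRHS]mulrAC; apply: ler_pM => //.
      by rewrite mulr_ge0// divr_ge0 ?mulr_ge0// ?ltW.
    apply: le_trans kd; rewrite ler_piMl ?invr_2pi_le1//.
    by rewrite divr_ge0 ?mulr_ge0// ltW.
  apply: (@le_trans _ _ (4 * dl * far p)); last by rewrite /g lerDr !addr_ge0.
  have q0 : 0 < cmod (cplx p) by rewrite cmod_gt0.
  have qc : cmod (cplx p) <= cmod z + cmod (z - cplx p).
    by rewrite -[X in cmod X <= _](subKr z) cmodB.
  (* With c = |z - p| > 4 R0 >= 4, |p| <= R0 + c <= 2 c^2. *)
  have cq : 2 * (cmod (z - cplx p)) ^- 2 <= 4 / cmod (cplx p).
    rewrite ler_pdivrMr ?exprn_gt0// mulrAC ler_pdivlMr//.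
    move: cr qc; rewrite /r; move: (cmod (z - cplx p)) => c; nra.
  rewrite /far (cmodM (BS_kernel _)) cmod_BS_kernel sub0r cmodN.
  rewrite [leRHS]mulrA ler_wpM2r// [leRHS]mulrCA ler_wpM2l// (le_trans kd)//.
  by rewrite (mulrC 2) (mulrC 4) -!mulrA ler_wpM2l// ltW.
have I1 := integral_near_kernel z dl20.
have I2 := integral_near_kernel z' (mulr_gt0 (ltr0n R 3) dl0).
have I3 := integral_annulus_kernel z k.+1 r0.
apply: (@le_trans _ _ (M * (16 * (2 * dl)) + M * (16 * (3 * dl)) +
   2 * dl * M * (16 * k.+1%:R) + 4 * dl * B)%:E).
  have q12 p : 0 <= M * g1 p + M * g2 p by rewrite addr_ge0.
  have mq12 := measurable_funD mM1 mM2.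
  have q123 p : 0 <= M * g1 p + M * g2 p + 2 * dl * M * g3 p by rewrite addr_ge0.
  have mq123 := measurable_funD mq12 mM3.
  apply: integralD_le => //; last exact: integralZ_le.
  apply: integralD_le => //; last exact: integralZ_le.
  by apply: integralD_le => //; exact: integralZ_le.
rewrite lee_fin.
(* From 2 |z - z'| <= r / 2^k and ln 2 >= 1/2. The terms free of k add up to 32 + 48 + 32 = 112 <=
   64 * 2, which the summand 2 beside ln (4 R0) absorbs. *)
have kln : k%:R <= 2 * (ln r - ln dl).
  have : ln (2 * dl) <= ln (r / 2 ^+ k).
    by rewrite ler_ln ?posrE// divr_gt0// exprn_gt0.
  rewrite ln_div ?posrE ?exprn_gt0// lnXn// lnM ?posrE// -[ln 2 *+ k]mulr_natl => h.
  have : k%:R * (1 / 2) <= k%:R * ln 2 :> R by rewrite ler_wpM2l// ln2_ge.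
  have := ln2_ge; lra.
have Md : 0 <= dl * M by rewrite mulr_ge0// ltW.
have := ler_wpM2l Md kln; rewrite -[k.+1%:R]natr1; nra.
Qed.

Lemma cmod_velocityB_le z z' (R0 : R) : 1 <= R0 ->
  cmod z <= R0 -> cmod z' <= R0 ->
  cmod (vel z - vel z') <=
  2 * (cmod (z - z') * (64 * M * ((2 + ln (4 * R0)) - ln (cmod (z - z'))) +
    4 * B)).
Proof.
move=> R01 zR z'R; have [->|zz'] := eqVneq z z'.
  by rewrite !subrr cmod0 mul0r mulr0.
rewrite -cintegralB//; last 2 first.
- exact: cintegrable_BS.
- exact: cintegrable_BS.
apply: cmod_cintegral_le (integral_BSB_le R01 zz' zR z'R) => //.
by apply: cintegrableB => //; exact: cintegrable_BS.
Qed.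

End VelocityEstimates.

(** * The flow of an Euler solution *)

Section EssentialBound.
Context {R : realType}.
Local Notation mR := (measurableTypeR R).
Local Notation plane := (mR * mR)%type.
Implicit Types f : R[i] -> R[i].

(** The norm of exponent +oo is an essential supremum only on a space of positive measure. *)
Lemma leb2_setT_gt0 : (0 < @leb2 R setT)%E.
Proof.
apply: (@lt_le_trans _ _ (leb2 (square (0 : R[i]) 1))).
  by rewrite leb2_square// expr1n mulr1 lte_fin.
apply: (le_measure leb2); rewrite ?inE//; exact: measurable_square.
Qed.

Lemma Linfty_normE f :
  Linfty_norm f = ess_sup leb2 (fun p : plane => (cmod (f (cplx p)))%:E).
Proof.
rewrite /Linfty_norm unlock/= leb2_setT_gt0; congr (ess_sup _ _).
by apply/funext => p /=; rewrite ger0_norm ?cmod_ge0.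
Qed.

Lemma Linfty_normP f (M : R) : (Linfty_norm f <= M%:E)%E <->
  {ae leb2, forall p : plane, cmod (f (cplx p)) <= M}.
Proof.
rewrite Linfty_normE; split.
  move=> /ess_supP; by apply: filterS => p; rewrite lee_fin.
by move=> h; apply/ess_supP; apply: filterS h => p; rewrite lee_fin.
Qed.

Lemma Linfty_norm_ge0 f : (0 <= Linfty_norm f)%E.
Proof. exact: Lnorm_ge0. Qed.

End EssentialBound.

Section SpaceTime.
Context {R : realType}.
Local Notation mR := (measurableTypeR R).
Local Notation plane := (mR * mR)%type.
Variable T : R.

Lemma measurable_slab : measurable (slab T : set (mR * plane)).
Proof.
have -> : slab T = (`[0, T]%classic : set mR) `*` (setT : set plane).
  by apply/seteqP; split => [[t p]|[t p] []].
exact: measurableX.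
Qed.

Lemma measurable_section (f : R -> plane -> R) (t : R) : t \in `[0, T] ->
  measurable_fun (slab T) (fun q : mR * plane => f q.1 q.2) ->
  measurable_fun setT (f t).
Proof.
move=> tT mf.
have := (measurable_restrictT _ measurable_slab).1 mf.
move=> /measurableT_comp/(_ (pair1_measurable (t : mR))).
apply: eq_measurable_fun => p _ /=.
by rewrite patchE ifT// inE.
Qed.

Lemma cmeasurable_section (w : R -> R[i] -> R[i]) (t : R) : t \in `[0, T] ->
  cmeasurable (slab T) (fun q : mR * plane => w q.1 (cplx q.2)) ->
  cmeasurable setT (fun p : plane => w t (cplx p)).
Proof.
move=> tT [mr mi]; split.
  exact: (measurable_section (f := fun t p => complex.Re (w t (cplx p)))).
exact: (measurable_section (f := fun t p => complex.Im (w t (cplx p)))).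
Qed.

(** Fubini: b(t) is the integral of the slice at time t. *)
Lemma integrable_slice (f : R -> plane -> R) :
  (forall t p, 0 <= f t p) ->
  leb3.-integrable (slab T) (fun q : mR * plane => (f q.1 q.2)%:E) ->
  exists b : R -> R, [/\ forall t, 0 <= b t,
    leb1.-integrable setT (EFin \o b) &
    {ae leb1, forall t : R, t \in `[0, T] ->
      (\int[leb2]_p (f t p)%:E <= (b t)%:E)%E}].
Proof.
move=> f0 if_.
have := (integrable_mkcond _ measurable_slab).1 if_.
set F := _ \_ _ => iF.
have F0 q : (0 <= F q)%E.
  by rewrite /F patchE; case: ifP => // _; rewrite lee_fin.
have iG := integrable_fubini_F iF.
pose G := fubini_F leb2 F.
have G0 t : (0 <= G t)%E by exact: integral_ge0.
(* [fine] turns an infinite slice integral into 0; this happens only on a null set of times. *)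
exists (fun t => fine (G t)); split.
- by move=> t; rewrite fine_ge0.
- apply: (le_integrable _ _ _ iG) => //.
    apply/measurable_EFinP; apply: measurableT_comp => //.
    exact: measurable_int iG.
  move=> t _ /=; rewrite ger0_norm ?fine_ge0// gee0_abs; last exact: G0.
  by rewrite -/(G t); case: (G t) (G0 t) => [r _|_|] //=; rewrite leey.
have := integrable_ae measurableT iG.
apply: filterS => t /(_ I) Gfin tT.
rewrite fineK// le_eqVlt; apply/orP; left; apply/eqP.
apply: eq_integral => p _; rewrite /F patchE ifT//.
by rewrite inE.
Qed.

End SpaceTime.

Section TimeIntegrals.
Context {R : realType}.
Local Notation mR := (measurableTypeR R).
Variables (T : R) (b : R -> R).
Hypothesis b0 : forall t, 0 <= b t.
Hypothesis ib : (@leb1 R).-integrable setT (EFin \o b).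

Let Bint (t : R) : R := Rintegral leb1 (`[0, t]%classic : set mR) b.

Let integrable_itv (I : interval R) :
  (@leb1 R).-integrable ([set` I] : set mR) (EFin \o b).
Proof. exact: (integrableS measurableT) ib. Qed.

Lemma cintegral_increment (G : R -> R[i]) (s s' : R) :
  cintegrable leb1 (`[0, T]%classic : set mR) G -> 0 <= s -> s <= s' -> s' <= T ->
  cintegral leb1 (`[0, s']%classic : set mR) G -
    cintegral leb1 (`[0, s]%classic : set mR) G =
  cintegral leb1 (`]s, s']%classic : set mR) G.
Proof.
move=> [Gr Gi] s0 ss' s'T.
have h (f : R -> R) :
    (@leb1 R).-integrable (`[0, T]%classic : set mR) (fun x => (f x)%:E) ->
    Rintegral leb1 (`[0, s']%classic : set mR) f -
      Rintegral leb1 (`[0, s]%classic : set mR) f =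
    Rintegral leb1 (`]s, s']%classic : set mR) f.
  move=> if_; apply: (@Rintegral_itvB R f (BLeft 0) (BRight s') s) => //.
  apply: (integrableS _ _ _ if_) => //; apply: subset_itvl.
  by rewrite bnd_simp.
rewrite /cintegral; apply/eqP; rewrite eq_complex/= !h//.
by rewrite !eqxx.
Qed.

Lemma Bint_increment (s s' : R) : 0 <= s -> s <= s' ->
  Bint s' - Bint s = Rintegral leb1 (`]s, s']%classic : set mR) b.
Proof.
move=> s0 ss'; apply: (@Rintegral_itvB R b (BLeft 0) (BRight s') s) => //.
Qed.

Lemma Bint_nd (s s' : R) : 0 <= s -> s <= s' -> s' <= T -> Bint s <= Bint s'.
Proof.
by move=> s0 ss' _; rewrite -subr_ge0 Bint_increment// Rintegral_ge0.
Qed.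

Let leb1_itv (s s' : R) : s <= s' ->
  leb1 (`]s, s']%classic : set mR) = (s' - s)%:E.
Proof.
move=> ss'; rewrite [LHS](lebesgue_measure_itv `]s, s'])/= lte_fin.
case: ltP => // h; rewrite (_ : s' = s) ?subrr//.
by apply/eqP; rewrite eq_le h ss'.
Qed.

(** Absolute continuity of the integral: b is merely integrable, so no Lipschitz bound in time can
    be expected. *)
Lemma Bint_uc (e : R) : 0 < e -> exists2 d : R, 0 < d &
  forall s s' : R, 0 <= s -> s <= s' -> s' <= T -> s' - s < d ->
    Bint s' - Bint s < e.
Proof.
move=> e0; have [d [d0 hd]] := integral_normr_continuous ib e0.
exists d => // s s' s0 ss' _ sd; rewrite Bint_increment//.
have hm : (leb1 (`]s, s']%classic : set mR) < d%:E)%E by rewrite leb1_itv// lte_fin.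
apply: le_lt_trans (hd (`]s, s']%classic : set mR) _ hm) => //.
rewrite le_eqVlt; apply/orP; left; apply/eqP/eq_Rintegral => x _.
by rewrite ger0_norm.
Qed.

Lemma cmod_cintegral_itv_le (G : R -> R[i]) (s s' c1 c2 : R) :
  0 <= c1 -> 0 <= c2 -> 0 <= s -> s <= s' ->
  cintegrable leb1 (`]s, s']%classic : set mR) G ->
  {ae leb1, forall t : R, t \in `]s, s'] -> cmod (G t) <= c1 + c2 * b t} ->
  cmod (cintegral leb1 (`]s, s']%classic : set mR) G) <=
  2 * (c1 * (s' - s) + c2 * (Bint s' - Bint s)).
Proof.
move=> c10 c20 s0 ss' iG Gb.
have mI : measurable (`]s, s']%classic : set mR) by [].
have ic : (@leb1 R).-integrable (`]s, s']%classic : set mR) (EFin \o cst c1).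
  apply/integrableP; split; first exact/measurable_EFinP/measurable_cst.
  rewrite (eq_integral (cst `|c1|%:E))// integral_cst//= [X in (_ * X < _)%E]leb1_itv//.
  by rewrite -EFinM ltry.
have icb : (@leb1 R).-integrable (`]s, s']%classic : set mR)
    (EFin \o (fun t => c2 * b t)).
  have := integrableZl mI c2 (integrable_itv `]s, s']).
  by apply: eq_integrable => // x _; rewrite /= EFinM.
have iD : (@leb1 R).-integrable (`]s, s']%classic : set mR)
    (EFin \o (fun t => c1 + c2 * b t)).
  by have := integrableD mI ic icb; apply: eq_integrable.
apply: cmod_cintegral_le => //.
apply: (@le_trans _ _ (\int[leb1]_(t in (`]s, s']%classic : set mR))
  (c1 + c2 * b t)%:E)%E).
  apply: ae_ge0_le_integral => //.
  - by move=> t _; rewrite lee_fin cmod_ge0.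
  - exact/measurable_EFinP/measurable_cmod/(cintegrable_cmeasurable iG).
  - by move=> t _; rewrite lee_fin addr_ge0// mulr_ge0.
  - exact: measurable_int iD.
rewrite -[leLHS]fineK ?integrable_fin_num//.
have e1 := RintegralD mI ic icb.
have e2 := RintegralZl c2 mI (integrable_itv `]s, s']).
have e3 := @Rintegral_cst _ _ _ leb1 _ mI c1.
rewrite Bint_increment// -e2 lee_fin [leLHS]e1 lerD2r [leLHS]e3.
by rewrite [X in fine X]leb1_itv.
Qed.

End TimeIntegrals.

Section EulerFlow.
Context {R : realType}.
Local Notation mR := (measurableTypeR R).
Local Notation plane := (mR * mR)%type.
Variables (T M : R) (w X : R -> R[i] -> R[i]).
Hypothesis T0 : 0 <= T.
Hypothesis M0 : 0 <= M.
Hypothesis mw : cmeasurable (slab T) (fun q : mR * plane => w q.1 (cplx q.2)).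
Hypothesis wM : {ae leb1, forall t : R, t \in `[0, T] ->
  (Linfty_norm (w t) <= M%:E)%E}.
Hypothesis wBS : BS_convergent T w.
Hypothesis hX : is_flow T (velocity w) X.

(** One null set of times serves all points z, because the almost-everywhere inputs are only the
    bound on the vorticity and the slice at the origin. The estimates can thus be evaluated along
    moving trajectories. *)
Lemma velocity_bounds : exists b : R -> R,
  [/\ forall t, 0 <= b t, leb1.-integrable setT (EFin \o b) &
    {ae leb1, forall t : R, t \in `[0, T] ->
      (forall z, cmod (velocity w t z) <= 2 * (16 * M + (1 + cmod z) * b t)) /\
      (forall z z' R0, 1 <= R0 -> cmod z <= R0 -> cmod z' <= R0 ->
        cmod (velocity w t z - velocity w t z') <=
        2 * (cmod (z - z') * (64 * M * ((2 + ln (4 * R0)) - ln (cmod (z - z'))) +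
          4 * b t)))}].
Proof.
have i0 := integrable_cmod (measurable_slab T) (wBS 0).
have [b [b0 ib bB]] := integrable_slice (f := fun (t : R) (p : plane) =>
  cmod (BS_kernel (0 - cplx p) * w t (cplx p))) (fun _ _ => cmod_ge0 _) i0.
exists b; split => //.
apply: (@filterS2 mR (almost_everywhere leb1) _ _ _ _ _ wM bB) => t tM tB tT.
have mwt := cmeasurable_section tT mw.
have wMt := (Linfty_normP _ _).1 (tM tT).
split=> [z|z z' R0 R01 zR z'R].
  exact: (cmod_velocity_le M0 mwt wMt (tB tT)).
exact: (cmod_velocityB_le M0 mwt wMt (tB tT)).
Qed.

Lemma flow_increment_integral y (s s' : R) : 0 <= s -> s <= s' -> s' <= T ->
  X s' y - X s y =
  cintegral leb1 (`]s, s']%classic : set mR) (fun r => velocity w r (X r y)).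
Proof.
move=> s0 ss' s'T; have [iv XE] := hX y.
rewrite (XE s') ?(XE s) ?in_itv/= ?s0 ?(le_trans ss')//; last first.
  by rewrite s'T (le_trans s0).
rewrite opprD addrACA subrr add0r.
exact: (cintegral_increment iv).
Qed.

Lemma flow_start y : X 0 y = y.
Proof.
have [_ ->] := hX y; last by rewrite in_itv/= lexx T0.
rewrite set_itv1 /cintegral [X in X +i* _](Rintegral_set1 _ (0 : R)).
by rewrite [X in _ +i* X](Rintegral_set1 _ (0 : R)) addr0.
Qed.

Lemma cintegrable_velocity y (s s' : R) : 0 <= s -> s' <= T ->
  cintegrable leb1 (`]s, s']%classic : set mR) (fun r => velocity w r (X r y)).
Proof.
move=> s0 s'T; have [[ir ii] _] := hX y.
have sub : (`]s, s']%classic : set mR) `<=` (`[0, T]%classic : set mR).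
  move=> r /=; rewrite !in_itv/= => /andP[sr rs'].
  by rewrite (le_trans s0 (ltW sr)) (le_trans rs').
by split; [apply: integrableS ir|apply: integrableS ii].
Qed.

(** The velocity grows at most linearly, so Gronwall applies. The radius obtained fixes the disc,
    hence the constant, of the log-Lipschitz estimate. *)
Lemma flow_bounded : exists2 R0 : R, 1 <= R0 &
  forall y (s : R), cmod y <= 1 -> 0 <= s <= T -> cmod (X s y) <= R0.
Proof.
have [b [b0 ib vb]] := velocity_bounds.
pose Bint (t : R) : R := Rintegral leb1 (`[0, t]%classic : set mR) b.
pose H (t : R) := 64 * M * 1 * t + 4 * Bint t.
have M640 : 0 <= 64 * M by rewrite mulr_ge0 ?ler0n.
have B4nd (s s' : R) : 0 <= s -> s <= s' -> s' <= T -> 4 * Bint s <= 4 * Bint s'.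
  by move=> s0 ss' s'T; rewrite ler_wpM2l// (Bint_nd b0 ib _ _ s'T).
have B4uc (e : R) : 0 < e -> exists2 d : R, 0 < d &
    forall s s' : R, 0 <= s -> s <= s' -> s' <= T -> s' - s < d ->
    4 * Bint s' - 4 * Bint s < e.
  move=> e0; have e4 : 0 < e / 4 by rewrite divr_gt0.
  have [d d0 hd] := Bint_uc T b0 ib e4.
  exists d => // s s' s0 ss' s'T /hd-/(_ s0 ss' s'T); rewrite -/(Bint _) -/(Bint s).
  lra.
have Hnd := time_weight_nd M640 B4nd (@ler01 R).
have Huc := time_weight_uc M640 B4uc (@ler01 R).
exists (2 * expR (2 * (H T - H 0))) => [|y s y1 sT].
  rewrite -[leLHS]mulr1 ler_pM// ?ler1n// -expR0 ler_expR mulr_ge0// subr_ge0.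
  exact: Hnd.
(* Adding 1 makes every upper bound S of f at least 1, so the constant part of the velocity bound
   may also be multiplied by S. *)
pose f (s : R) := 1 + cmod (X s y).
have [iv XE] := hX y.
have ic := integrable_cmod (_ : measurable (`[0, T]%classic : set mR)) iv.
(* The a priori bound that [gronwall] asks for, from integrability of the velocity along the
   trajectory. *)
pose K := fine (\int[leb1]_(r in (`[0, T]%classic : set mR))
  (cmod (velocity w r (X r y)))%:E).
have fK (u : R) : 0 <= u <= T -> 0 <= f u <= 1 + (1 + 2 * K).
  move=> /andP[u0 uT]; rewrite addr_ge0 ?cmod_ge0//= lerD2l.
  rewrite XE ?in_itv/= ?u0//; apply: le_trans (cmodD _ _) _; apply: lerD => //.
  have sub : (`[0, u]%classic : set mR) `<=` (`[0, T]%classic : set mR).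
    by move=> r /=; rewrite !in_itv/= => /andP[-> ru]; rewrite (le_trans ru).
  apply: cmod_cintegral_le => //.
    by have [ir ii] := iv; split; [apply: integrableS ir|apply: integrableS ii].
  rewrite fineK ?integrable_fin_num//; last exact: ic.
  apply: ge0_subset_integral => //; first exact: measurable_int (ic _).
  by move=> r _; rewrite lee_fin cmod_ge0.
have fS (u u' S : R) : 0 <= u -> u <= u' -> u' <= T ->
    (forall r : R, u <= r <= u' -> f r <= S) -> f u' <= f u + S * (H u' - H u).
  move=> u0 uu' u'T hS.
  have S1 : 1 <= S.
    by apply: le_trans (hS u _); rewrite ?lexx// lerDl cmod_ge0.
  have -> : f u' = 1 + cmod (X u y + (X u' y - X u y)).
    by rewrite (addrC (X u y)) subrK.
  rewrite /f -[leRHS]addrA lerD2l; apply: le_trans (cmodD _ _) _; rewrite lerD2l.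
  rewrite flow_increment_integral//.
  apply: le_trans (cmod_cintegral_itv_le (c1 := 32 * M) (c2 := 2 * S)
    b0 ib _ _ u0 uu' _ _) _.
  - by rewrite mulr_ge0.
  - by rewrite mulr_ge0// (le_trans _ S1).
  - exact: cintegrable_velocity.
  - apply: (@filterS mR (almost_everywhere leb1) _ _ _ _ vb) => r vr.
    rewrite in_itv/= => /andP[ur ru'].
    have [|+ _] := vr; first by rewrite in_itv/= (le_trans u0 (ltW ur)) (le_trans ru').
    move=> /(_ (X r y))/le_trans; apply.
    have : f r <= S by apply: hS; rewrite (ltW ur).
    move=> /(ler_wpM2r (b0 r)); rewrite /f; lra.
  - rewrite -/(Bint u) -/(Bint u').
    have : 0 <= (S - 1) * (64 * M * (u' - u)).
      by rewrite !mulr_ge0// subr_ge0.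
    rewrite /H; lra.
have := gronwall T0 fK Hnd Huc fS sT.
rewrite {1 2}/f flow_start => fs.
apply: (@le_trans _ _ (1 + cmod (X s y))); first by rewrite lerDr.
have y2 : 1 + cmod y <= 2 by lra.
have Hs : expR (2 * (H s - H 0)) <= expR (2 * (H T - H 0)).
  by rewrite ler_expR ler_wpM2l ?ler0n// lerD2r; case/andP: sT => s0 sT; exact: Hnd.
apply: le_trans fs (ler_pM _ (expR_ge0 _) y2 Hs).
by rewrite addr_ge0 ?cmod_ge0.
Qed.

Lemma euler_rotation_bound : exists2 K : R, 0 <= K &
  forall (t : R) z, 0 <= t <= T -> 0 < cmod z < 1 ->
  exists2 a : R,
    continued_arg (fun y => (X t y - X t 0) / (X t 1 - X t 0)) z a &
    `|a| <= K * (1 + M * t * (1 - ln (cmod z))).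
Proof.
have [R0 R01 XR] := flow_bounded.
have [b [b0 ib vb]] := velocity_bounds.
pose Bint (t : R) : R := Rintegral leb1 (`[0, t]%classic : set mR) b.
(* The constant of the log-Lipschitz estimate; as |X_s(y) - X_s(y')| <= 2 R0, it also makes Lam at
   least 1. *)
pose A : R := 2 + ln (4 * R0).
have A1 : 1 <= A by rewrite /A; have := ln_ge0 (_ : 1 <= 4 * R0); lra.
(* 256 = 64 * 2 * 2, and likewise 16 = 4 * 2 * 2 below: one factor 2 for the integral over the
   plane, one for the integral over time. *)
have M0' : 0 <= 256 * M by rewrite mulr_ge0 ?ler0n.
have Bnd (s s' : R) : 0 <= s -> s <= s' -> s' <= T -> 16 * Bint s <= 16 * Bint s'.
  by move=> s0 ss' s'T; rewrite ler_wpM2l// (Bint_nd b0 ib _ _ s'T).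
have Buc (e : R) : 0 < e -> exists2 d : R, 0 < d &
    forall s s' : R, 0 <= s -> s <= s' -> s' <= T -> s' - s < d ->
    16 * Bint s' - 16 * Bint s < e.
  move=> e0; have e16 : 0 < e / 16 by rewrite divr_gt0.
  have [d d0 hd] := Bint_uc T b0 ib e16.
  exists d => // s s' s0 ss' s'T /hd-/(_ s0 ss' s'T); rewrite -/(Bint _) -/(Bint s).
  lra.
have Lam1 y y' (s : R) : cmod y <= 1 -> cmod y' <= 1 -> 0 <= s <= T ->
    1 <= A - ln (cmod (X s y - X s y')).
  move=> y1 y'1 sT.
  have [r0|r0] := leP (cmod (X s y - X s y')) 0; first by rewrite ln0// subr0.
  have : ln (cmod (X s y - X s y')) <= ln (4 * R0).
    rewrite ler_ln ?posrE//; last by lra.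
    apply: le_trans (cmodB _ _) _.
    by have := XR _ _ y1 sT; have := XR _ _ y'1 sT; lra.
  rewrite /A; lra.
have core y y' (s s' S1 S2 : R) : cmod y <= 1 -> cmod y' <= 1 -> 0 <= s ->
    s <= s' -> s' <= T ->
    (forall r : R, s <= r <= s' ->
      cmod (X r y - X r y') * (A - ln (cmod (X r y - X r y'))) <= S1 /\
      cmod (X r y - X r y') <= S2) ->
    cmod ((X s' y - X s' y') - (X s y - X s y')) <=
      256 * M * S1 * (s' - s) + S2 * (16 * Bint s' - 16 * Bint s).
  move=> y1 y'1 s0 ss' s'T hS.
  have /hS[hS1 hS2] : s <= s <= s' by rewrite lexx.
  have sT : 0 <= s <= T by rewrite s0 (le_trans ss').
  have S20 : 0 <= S2 by exact: le_trans (cmod_ge0 _) hS2.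
  have S10 : 0 <= S1.
    apply: le_trans hS1; rewrite mulr_ge0 ?cmod_ge0//.
    by rewrite (le_trans _ (Lam1 _ _ _ y1 y'1 sT)).
  have -> : X s' y - X s' y' - (X s y - X s y') =
    (X s' y - X s y) - (X s' y' - X s y') by ring.
  rewrite !flow_increment_integral// -cintegralB//; last 2 first.
  - exact: cintegrable_velocity.
  - exact: cintegrable_velocity.
  apply: le_trans (cmod_cintegral_itv_le (c1 := 128 * M * S1) (c2 := 8 * S2)
    b0 ib _ _ s0 ss' _ _) _.
  - by rewrite !mulr_ge0.
  - by rewrite mulr_ge0.
  - by apply: cintegrableB => //; exact: cintegrable_velocity.
  - apply: (@filterS mR (almost_everywhere leb1) _ _ _ _ vb) => r vr.
    rewrite in_itv/= => /andP[sr rs'].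
    have rT : 0 <= r <= T by rewrite (le_trans s0 (ltW sr)) (le_trans rs').
    have [|_] := vr; first by rewrite in_itv.
    move=> /(_ (X r y) (X r y') _ R01 (XR _ _ y1 rT) (XR _ _ y'1 rT)).
    rewrite -/A => /le_trans; apply.
    have [|h1 h2] := hS r; first by rewrite (ltW sr).
    have := ler_wpM2l M0 h1; have := ler_wpM2r (b0 r) h2; lra.
  - rewrite -/(Bint s) -/(Bint s') le_eqVlt; apply/orP; left; apply/eqP; ring.
have rot := flow_rotation T0 M0' flow_start Bnd Buc Lam1 core.
set h := 16 * (_ - _) in rot.
have BT : 0 <= Bint T by rewrite Rintegral_ge0.
have A0 : 0 <= A by exact: le_trans A1.
(* The growth of [Bint] is bounded by its value at T, and A - ln |z| <= A (1 - ln |z|) because A >=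
   1 and ln |z| <= 0. *)
exists (2 * pi + 8 * (16 * Bint T) + 8 * (256 * (expR h * A))).
  by rewrite !addr_ge0 ?mulr_ge0 ?ler0n ?pi_ge0 ?expR_ge0 ?BT ?A0.
move=> t z tT z01; have [a ca ba] := rot t z tT z01.
exists a => //; apply: le_trans ba _; move/andP: tT => [t0 tT].
case/andP: z01 => z0 z1.
have l0 : 0 <= - ln (cmod z) by rewrite oppr_ge0 ln_le0// ltW.
have Bt : Bint t <= Bint T by exact: (Bint_nd b0 ib t0 tT (lexx _)).
have B0 : 0 <= Bint 0 by rewrite Rintegral_ge0.
have Mt : 0 <= M * t by rewrite mulr_ge0.
have e0 : 0 <= expR h by exact: expR_ge0.
have AL : A - ln (cmod z) <= A * (1 - ln (cmod z)).
  by have : 0 <= (A - 1) * - ln (cmod z); [rewrite mulr_ge0// subr_ge0|lra].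
have p1 : expR h * (M * t) * (A - ln (cmod z)) <=
    expR h * (M * t) * (A * (1 - ln (cmod z))).
  by rewrite ler_wpM2l// mulr_ge0.
have p2 : 0 <= (2 * pi + 8 * (16 * Bint T)) * (M * t * (1 - ln (cmod z))).
  apply: mulr_ge0; last by rewrite mulr_ge0 ?addr_ge0.
  by rewrite !addr_ge0 ?mulr_ge0 ?ler0n ?pi_ge0 ?BT.
have p3 : 0 <= expR h * A by rewrite mulr_ge0.
lra.
Qed.

End EulerFlow.

(** * Vanishing initial vorticity *)

Section AlmostEverywhereZero.
Context {R : realType} d (U : measurableType d) (mu : {measure set U -> \bar R}).
Import HBNNSimple.

(* The integral of a nonnegative function is a supremum over the simple functions
   below it, whether or not it is measurable. *)
Lemma integral_ae0 (f : U -> \bar R) :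
  {ae mu, forall x, f x = 0%E} -> (\int[mu]_x f x = 0)%E.
Proof.
have key (g : U -> \bar R) : (forall x, (0 <= g x)%E) ->
    {ae mu, forall x, g x = 0%E} -> (\int[mu]_x g x = 0)%E.
  move=> g0 gae; apply/eqP; rewrite eq_le integral_ge0// andbT.
  rewrite ge0_integralTE//; apply: ge_ereal_sup => _ [h hg <-].
  have := integral_nnsfun mu measurableT h; rewrite patch_setT => <-.
  rewrite (ae_eq_integral (cst 0%E)) ?integral0//.
    exact/measurable_EFinP.
  apply: filterS gae => x gx _; apply/eqP; rewrite eq_le.
  by rewrite -[in X in (_ <= X)%E]gx hg lee_fin fun_ge0.
move=> fae; rewrite integralE !key ?sube0//.
  by apply: filterS fae => x fx; rewrite funenegE fx oppe0 maxxx.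
by apply: filterS fae => x fx; rewrite funeposE fx maxxx.
Qed.

Lemma cintegral_ae0 (f : U -> R[i]) :
  {ae mu, forall x, f x = 0} -> cintegral mu setT f = 0.
Proof.
move=> fae; rewrite /cintegral /Rintegral !integral_ae0//.
  by apply: filterS fae => x ->.
by apply: filterS fae => x ->.
Qed.

End AlmostEverywhereZero.

Section ZeroVorticity.
Context {R : realType}.
Local Notation mR := (measurableTypeR R).
Local Notation plane := (mR * mR)%type.

Lemma cintegral0 d (U : measurableType d) (mu : {measure set U -> \bar R})
    (E : set U) (f : U -> R[i]) :
  (forall x, f x = 0) -> cintegral mu E f = 0.
Proof.
move=> f0; rewrite /cintegral /Rintegral.
by rewrite !integral0_eq// => x _; rewrite f0.
Qed.

Lemma euler_solution0 (T : R) (w0 : R[i] -> R[i]) :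
  Linfty_norm w0 = 0%E -> euler_solution T w0 (fun _ _ => 0).
Proof.
move=> w00.
have vel0 t z : velocity (fun _ _ => 0 : R[i]) t z = 0.
  by apply: cintegral0 => p; rewrite mulr0.
split.
- split; first exact: cmeasurable_cst.
  exists 0; apply: (@aeW _ mR _ leb1) => t _.
  by apply/Linfty_normP; apply: (@aeW _ plane _ leb2) => p; rewrite cmod0.
- move=> z; have z0 (f : mR * plane -> R) : f = cst 0 ->
      (@leb3 R).-integrable (slab T) (EFin \o f).
    by move=> ->; exact: integrable0.
  by split; apply: z0; apply/funext => q; rewrite mulr0.
- move=> phi _; rewrite /Rintegral integral0_eq// => q _.
  by rewrite /advect vel0/= !mul0r addr0.
- move=> phi _; rewrite cintegral0 ?add0r => [|q]; last by rewrite mul0r.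
  apply: cintegral_ae0.
  have : (Linfty_norm w0 <= 0%:E)%E by rewrite w00.
  move=> /Linfty_normP; apply: filterS => p.
  rewrite le_eqVlt ltNge cmod_ge0 orbF cmod_eq0 => /eqP ->.
  by rewrite mul0r.
Qed.

(** Tonelli twice over: the integral of |w| over space-time vanishes, hence so do almost all slice
    integrals, and each such slice is zero almost everywhere. *)
Lemma ae_slab_eq0 (T : R) (w : R -> R[i] -> R[i]) :
  cmeasurable (slab T) (fun q : mR * plane => w q.1 (cplx q.2)) ->
  {ae leb3, forall q : mR * plane, slab T q -> 0 = w q.1 (cplx q.2)} ->
  {ae leb1, forall t : R, t \in `[0, T] -> (Linfty_norm (w t) <= 0%:E)%E}.
Proof.
move=> mw w0.
pose f (q : mR * plane) := (cmod (w q.1 (cplx q.2)))%:E.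
have mf : measurable_fun (slab T) f by exact/measurable_EFinP/measurable_cmod.
have mF := (measurable_restrictT _ (measurable_slab T)).1 mf.
set F := f \_ (slab T) in mF.
have F0 q : (0 <= F q)%E.
  by rewrite /F patchE; case: ifP => // _; rewrite lee_fin cmod_ge0.
have IF0 : (\int[leb3]_q F q = 0)%E.
  apply: integral_ae0; apply: filterS w0 => q; rewrite /F patchE /f.
  by case: ifP => // /[1!inE] qT /(_ qT) <-; rewrite cmod0.
have mG := measurable_fun_fubini_tonelli_F (m2 := leb2) F mF F0.
have /(ae_eq_integral_abs leb1 measurableT mG) :
    (\int[leb1]_t `|fubini_F leb2 F t| = 0)%E.
  rewrite -IF0 [RHS](fubini_tonelli1 F mF F0); apply: eq_integral => t _.
  by rewrite gee0_abs// integral_ge0.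
apply: (@filterS mR (almost_everywhere leb1)) => t /(_ I) Gt tT.
apply/Linfty_normP.
have mFt : measurable_fun setT (fun p : plane => F (t, p)).
  exact: (measurableT_comp mF (pair1_measurable _)).
have /(ae_eq_integral_abs leb2 measurableT mFt) : (\int[leb2]_p `|F (t, p)| = 0)%E.
  by rewrite -[RHS]Gt; apply: eq_integral => p _; rewrite gee0_abs.
apply: (@filterS plane (almost_everywhere leb2)) => p /(_ I).
by rewrite /F patchE /f ifT ?inE// => -[->].
Qed.

End ZeroVorticity.

(** * From the linear rotation bound to the stated inequality *)

Unset Implicit Arguments.

Theorem corollary2 (R : realType) (T : R) (hT : 0 < T)
    (omega0 : R[i] -> R[i]) (homega0 : Linfty omega0)
    (omega : R -> R[i] -> R[i]) (homega : Yudovich_solution T omega0 omega)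
    (X : R -> R[i] -> R[i]) (hX : is_flow T (velocity omega) X) :
  exists2 C : R, 0 < C &
  exists delta tau : R, [/\ 0 < delta, 0 < tau &
    forall (t : R) (z : R[i]),
      0 < t < tau -> t <= T -> z != 0 -> cmod z < delta ->
      exists2 a : R,
        continued_arg (fun y => (X t y - X t 0) / (X t 1 - X t 0)) z a &
        `|a| <= C * ln (1 / cmod z) `^ (1 / 2)
                * cmod z `^ (- (t * fine (Linfty_norm omega0)))
                * expR (C * t * fine (Linfty_norm omega0))].
Proof.
have [[[mw [M1 hM1]] BS _ _] uniq] := homega.
set m := fine (Linfty_norm omega0).
have normE : Linfty_norm omega0 = m%:E.
  by rewrite /m fineK// ge0_fin_numE ?Linfty_norm_ge0//; case: homega0.
have m0 : 0 <= m by rewrite fine_ge0// Linfty_norm_ge0.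
have [M [k [M0 k0 Mk wM]]] : exists M k : R, [/\ 0 <= M, 0 <= k, M <= k * m &
    {ae leb1, forall t : R, t \in `[0, T] -> (Linfty_norm (omega t) <= M%:E)%E}].
  have [m_eq0|m_neq0] := eqVneq m 0.
    (* M <= k m forces M = 0 here, so the solution itself must be shown to vanish. *)
    exists 0, 0; split; rewrite ?mul0r//; apply: ae_slab_eq0 => //.
    by apply: (uniq (fun _ _ => 0)); apply: euler_solution0; rewrite normE m_eq0.
  (* [M1] is any bound on the solution, not tied to [m]; the ratio records the dependence of C on
     the solution. *)
  exists `|M1|, (`|M1| / m); split; rewrite ?divr_ge0// ?divfK//.
  apply: (@filterS _ (almost_everywhere leb1) _ _ _ _ hM1) => t h /h/le_trans.
  by apply; rewrite lee_fin ler_norm.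
have [K K0 hK] := euler_rotation_bound (ltW hT) M0 mw wM BS hX.
have C0 : 0 <= K * (1 + 2 * k) by rewrite mulr_ge0// addr_ge0// mulr_ge0.
(* The leading 1 gives positivity; 2 k comes from M <= k m and 1 - ln |z| <= -2 ln |z|. *)
exists (1 + K * (1 + 2 * k)); first by rewrite ltr_wpDr.
(* |z| < 1/e makes ln (1/|z|) at least 1. *)
exists (expR (- 1)), 1; split=> [|//|t z /andP[t0 _] tT z0 zd]; first exact: expR_gt0.
have cz0 : 0 < cmod z by rewrite cmod_gt0.
have l1 : 1 <= - ln (cmod z).
  rewrite lerNr -[leRHS]expRK ler_ln ?posrE ?expR_gt0//; exact: ltW.
have [||a ha ba] := hK t z.
- by rewrite (ltW t0).
- by rewrite cz0/= (lt_le_trans zd)// -expR0 ler_expR oppr_le0.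
exists a => //; apply: le_trans ba _.
have tm : 0 <= t * m by rewrite mulr_ge0// ltW.
have tml : 0 <= t * m * - ln (cmod z) by rewrite mulr_ge0// (le_trans _ l1).
have h1 : 1 <= ln (1 / cmod z) `^ (1 / 2).
  rewrite div1r lnV ?posrE// -[leLHS](powRr0 (- ln (cmod z))).
  by rewrite ler_powR// divr_ge0.
have h2 : 1 + t * m * - ln (cmod z) <= cmod z `^ (- (t * m)).
  by rewrite /powR gt_eqF// mulNr -mulrN expR_ge1Dx.
have h3 : 1 <= expR ((1 + K * (1 + 2 * k)) * t * m).
  by rewrite -[leLHS]expR0 ler_expR -mulrA mulr_ge0// addr_ge0.
(* Only |z|^(-t m) >= 1 + t m ln (1/|z|) is needed to carry the growth; the logarithmic and
   exponential factors are bounded below by 1. *)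
apply: (@le_trans _ _ ((1 + K * (1 + 2 * k)) * 1 * (1 + t * m * - ln (cmod z)) * 1)).
  rewrite !mulr1.
  have e1 : M * t * (1 - ln (cmod z)) <= 2 * k * (t * m * - ln (cmod z)).
    apply: (@le_trans _ _ (k * m * t * (2 * - ln (cmod z)))); last by lra.
    by rewrite ler_pM ?mulr_ge0 ?ler_wpM2r ?(ltW t0)//; lra.
  have e2 : K * (1 + M * t * (1 - ln (cmod z))) <=
      K * (1 + 2 * k * (t * m * - ln (cmod z))) by rewrite ler_wpM2l// lerD2l.
  apply: le_trans e2 _.
  have e3 : 0 <= K * (t * m * - ln (cmod z)) by rewrite mulr_ge0.
  have e4 : 0 <= K * (2 * k) by rewrite mulr_ge0// mulr_ge0.
  lra.
have C1 : 0 <= 1 + K * (1 + 2 * k) by rewrite addr_ge0.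
have p1 : 0 <= 1 + t * m * - ln (cmod z) by rewrite addr_ge0.
apply: ler_pM => //; first by rewrite !mulr_ge0.
by rewrite mulr1 ler_pM// ler_peMr.
Qed.
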